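(* Let $\alpha>0$, let $C_0$ be a symmetric positive definite matrix on $X$, and let $(\boldsymbol i(t))_{t\ge0}$ be the index process. Let $(\theta^{(j)}(t))_{t\ge0,\,j\in J}$ satisfy $$\frac{\mathrm d\theta^{(j)}(t)}{\mathrm dt}=-\widehat C_t\,D_\theta\Phi^{\rm reg}_{\boldsymbol i(t)}(\theta^{(j)}(t))\quad(j\in J),\qquad \theta(0)=\theta_0,$$ where $\Phi^{\rm reg}_i(\theta)=\frac12\|\tilde y_i-\tilde A_i\theta\|^2$ for $i\in I$ and $\widehat C_t$ denotes the empirical covariance matrix of the particles $\theta^{(j)}(t)$. The tuple $(\boldsymbol i(t),\theta(t))_{t\ge0}$ is called the single subsampling TEKI (Tikhonov-regularised Ensemble Kalman inversion) solution without variance inflation. Then, for $j\in J$, $$\lim_{t\to\infty}\mathrm d_{\rm W}\bigl(\delta(\cdot-\theta^* ),\ \mathbb P(\theta^{(j)}(t)\in\cdot\mid\theta_0,i_0)\bigr)=0.$$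
   Context: Let $N_{\rm sub},N_{\rm ens}\ge2$ be integers, $I=\{1,\dots,N_{\rm sub}\}$, $J=\{1,\dots,N_{\rm ens}\}$. The parameter space is $X=\mathbb R^{N_{\rm ens}}$ with Euclidean norm. For $i\in I$, $A_i:X\to\mathbb R^{k_i}$ is linear and $y_i^\dagger\in\mathbb R^{k_i}$ is the $i$-th data subset. Set $\tilde A_i=\begin{pmatrix}A_i\\(\frac{\alpha}{N_{\rm sub}}C_0)^{1/2}\end{pmatrix}$ and $\tilde y_i=\begin{pmatrix}y_i^\dagger\\0\end{pmatrix}$. Let $A$ and $y^\dagger$ be obtained by stacking the $A_i$ and the $y_i^\dagger$, and set $\tilde A=\begin{pmatrix}A\\(\alpha C_0)^{1/2}\end{pmatrix}$, $\tilde y=\begin{pmatrix}y^\dagger\\0\end{pmatrix}$, $\Phi^{\rm reg}(\theta)=\frac12\|\tilde y-\tilde A\theta\|^2=\sum_{i\in I}\Phi^{\rm reg}_i(\theta)$. The initial ensemble is $\theta_0=(\theta_0^{(j)})_{j\in J}\in X^{N_{\rm ens}}$. Empirical mean and covariance: $\bar\theta(t)=\frac1{N_{\rm ens}}\sum_{j}\theta^{(j)}(t)$, $\widehat C_t=\frac1{N_{\rm ens}-1}\sum_{j=1}^{N_{\rm ens}}(\theta^{(j)}(t)-\bar\theta(t))(\theta^{(j)}(t)-\bar\theta(t))^\top$. $\mathcal E=\mathrm{span}\{\theta_0^{(j)}-\bar\theta(0):j\in J\}$, with $\dim\mathcal E=N_{\rm ens}-1$; $P_{\mathcal E}$ is the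 projection onto $\mathcal E$, and $\theta_0^\perp=\bar\theta(0)-P_{\mathcal E}\bar\theta(0)$. The point $\theta^*$ is the optimiser of the regularised problem constrained to the affine ensemble space: $\theta^*\in\mathrm{argmin}_{\theta\in\theta_0^\perp+\mathcal E}\ \frac12\|\tilde A\theta-\tilde y\|^2$. Index process: the learning rate $\eta:[0,\infty)\to(0,\infty)$ is continuously differentiable and bounded from above; $(\boldsymbol i(t))_{t\ge0}$ is the continuous-time Markov process on $I$ with initial distribution $\mathrm{Unif}(I)$ and transition rate matrix whose off-diagonal entries all equal $\frac1{(N_{\rm sub}-1)\eta(t)}$ and diagonal entries all equal $-\frac1{\eta(t)}$; conditioning on $i_0\in I$ means $\boldsymbol i(0)=i_0$. Wasserstein distance: $\mathrm d_{\rm W}(\pi,\pi')=\inf_{H\in C(\pi,\pi')}\int_{X\times X}\min\{1,\|\theta-\theta'\|^q\}\,\mathrm dH(\theta,\theta')$ with $q\in(0,1]$ and $C(\pi,\pi')$ the set of couplings of the probability measures $\pi,\pi'$ on $X$. $\delta(\cdot-\theta^* )$ is the Dirac measure at $\theta^*$. *)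

(* Defs.v *)
From HB Require Import structures.
From mathcomp Require Import all_boot all_order all_algebra.
From mathcomp Require Import all_classical all_reals all_analysis.

Set Implicit Arguments.
Unset Strict Implicit.
Unset Printing Implicit Defensive.

Import Order.TTheory GRing.Theory Num.Theory.
Import numFieldNormedType.Exports.

Local Open Scope classical_set_scope.
Local Open Scope ring_scope.

(* The norm that the library puts on matrices is the sup norm. It induces the
   same topology as the Euclidean norm, hence the same derivatives. *)
Definition enorm (R : realType) n (x : 'cV[R]_n) : R :=
  Num.sqrt (\sum_k x k 0 ^+ 2).

Definition grad (R : realType) n (f : 'cV[R]_n -> R) (x : 'cV[R]_n) :
    'cV[R]_n :=
  \col_k 'D_(delta_mx k 0) f x.

Definition argmin (R : realType) (T : Type) (S : set T) (f : T -> R) : set T :=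
  [set x | S x /\ forall z, S z -> f x <= f z].

Section MatrixRoot.
Variables (R : realType) (n : nat).

Definition posdefmx (M : 'M[R]_n) : Prop :=
  M^T = M /\ forall v : 'cV[R]_n, v != 0 -> 0 < (v^T *m M *m v) 0 0.

Definition possemidefmx (M : 'M[R]_n) : Prop :=
  M^T = M /\ forall v : 'cV[R]_n, 0 <= (v^T *m M *m v) 0 0.

(* The principal square root: a symmetric positive semidefinite matrix has
   exactly one symmetric positive semidefinite square root. *)
Definition sqrtmx (M : 'M[R]_n) : 'M[R]_n :=
  xget 0 [set S | possemidefmx S /\ S *m S = M].

End MatrixRoot.

Section LeastSquares.
Variables (R : realType) (n : nat).

Definition misfit m (A : 'M[R]_(m, n)) (y : 'cV[R]_m) (x : 'cV[R]_n) : R :=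
  2^-1 * enorm (y - A *m x) ^+ 2.

Definition reg_op m (A : 'M[R]_(m, n)) (M : 'M[R]_n) : 'M[R]_(m + n, n) :=
  col_mx A (sqrtmx M).

Definition reg_data m (y : 'cV[R]_m) : 'cV[R]_(m + n) := col_mx y 0.

Variables (Nsub : nat) (k : 'I_Nsub -> nat).
Variables (A : forall i, 'M[R]_(k i, n)) (y : forall i, 'cV[R]_(k i)).
Variables (alpha : R) (C0 : 'M[R]_n).

Definition Phi_reg_sub (i : 'I_Nsub) : 'cV[R]_n -> R :=
  misfit (reg_op (A i) ((alpha / Nsub%:R) *: C0)) (reg_data (y i)).

Definition Phi_reg : 'cV[R]_n -> R :=
  misfit (reg_op (\mxcol_i A i) (alpha *: C0)) (reg_data (\mxcol_i y i)).

End LeastSquares.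

Section Ensemble.
Variables (R : realType) (n N : nat).
Implicit Type x : 'I_N -> 'cV[R]_n.

Definition ens_mean x : 'cV[R]_n := N%:R^-1 *: \sum_j x j.

Definition ens_cov x : 'M[R]_n :=
  (N.-1)%:R^-1 *: \sum_j (x j - ens_mean x) *m (x j - ens_mean x)^T.

(* The span of the deviations from the mean is the row space of this matrix, so
   that v belongs to it when (v^T <= ens_span x)%MS, and its dimension is
   \rank (ens_span x). *)
Definition ens_span x : 'M[R]_(N, n) := \matrix_j (x j - ens_mean x)^T.

(* Row vectors u with u *m (ens_span x)^T = 0 form the orthogonal complement of
   the span, so this is the orthogonal projection onto the span. *)
Definition ens_proj x (v : 'cV[R]_n) : 'cV[R]_n :=
  (v^T *m proj_mx <<ens_span x>>%MS (kermx (ens_span x)^T))^T.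

Definition ens_perp x : 'cV[R]_n := ens_mean x - ens_proj x (ens_mean x).

Definition ens_affine x : set 'cV[R]_n :=
  [set v | ((v - ens_perp x)^T <= ens_span x)%MS].

End Ensemble.

Section IndexProcess.
Variable R : realType.

(* Continuously differentiable on the closed half-line: the derivative on the
   interior has a continuous extension to 0. *)
Definition learning_rate (eta : R -> R) : Prop :=
  [/\ forall t : R, 0 <= t -> 0 < eta t,
      exists M, forall t : R, 0 <= t -> eta t <= M,
      {within `[0, +oo[, continuous eta} &
      exists2 eta' : R -> R, {within `[0, +oo[, continuous eta'} &
        forall t : R, 0 < t -> is_derive t 1 eta (eta' t)].

Definition rate_matrix n (eta : R -> R) (t : R) : 'M[R]_n :=
  \matrix_(a, b) if a == b then - (eta t)^-1 else ((n.-1)%:R * eta t)^-1.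

(* p s t is the matrix of transition probabilities from time s to time t,
   characterised by Kolmogorov's forward equation for the rates Q. *)
Definition transition_function n (Q : R -> 'M[R]_n) (p : R -> R -> 'M[R]_n) :
    Prop :=
  forall s : R, 0 <= s ->
    [/\ p s s = 1%:M,
        {within `[s, +oo[, continuous (p s)} &
        forall t : R, s < t -> is_derive t 1 (p s) (p s t *m Q t)].

Variables (d : measure_display) (T : measurableType d) (P : probability T R).
Variable n : nat.
Implicit Type i : R -> T -> 'I_n.

Definition natural_filtration i (s : R) : set (set T) :=
  <<s [set B | exists2 r : R, 0 <= r <= s & exists a,
        B = [set w | i r w = a]] >>.

Definition cadlag_path (f : R -> 'I_n) : Prop :=
  (forall t : R, 0 <= t -> \forall s \near t^'+, f s = f t) /\
  (forall t : R, 0 < t -> exists a, \forall s \near t^'-, f s = a).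

(* P(i(t) = b | F_s) = p s t a b on {i(s) = a}, tested on the events of F_s. *)
Definition markov_process i (Q : R -> 'M[R]_n) : Prop :=
  exists2 p, transition_function Q p &
    forall s t : R, 0 <= s -> s <= t -> forall B, natural_filtration i s B ->
    forall a b,
      P (B `&` [set w | i s w = a] `&` [set w | i t w = b]) =
      (P (B `&` [set w | i s w = a]) * (p s t a b)%:E)%E.

Definition index_process (eta : R -> R) i : Prop :=
  [/\ forall (t : R) a, 0 <= t -> measurable [set w | i t w = a],
      forall w, cadlag_path (i ^~ w),
      forall a, P [set w | i 0 w = a] = (n%:R^-1)%:E &
      markov_process i (rate_matrix n eta)].

End IndexProcess.

Section Wasserstein.
Variables (R : realType) (n : nat).

Definition borel_cV := g_sigma_algebraType (@open 'cV[R]_n).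

(* Probability measures are passed as set functions; if one of the arguments is
   not a probability measure, then there is no coupling and the distance below
   is +oo. *)
Definition couplings (pi pi' : set borel_cV -> \bar R) :
    set (probability (borel_cV * borel_cV)%type R) :=
  [set H : probability (borel_cV * borel_cV)%type R |
    forall B : set borel_cV, measurable B ->
      H (B `*` setT) = pi B /\ H (setT `*` B) = pi' B].

Definition wasserstein (q : R) (pi pi' : set borel_cV -> \bar R) : \bar R :=
  ereal_inf
    [set \int[H]_z (Num.min 1 (enorm (z.1 - z.2 : 'cV[R]_n) `^ q))%:E
      | H in couplings pi pi']%E.

End Wasserstein.

Definition cond_prob (R : realType) (d : measure_display)
    (T : measurableType d) (P : probability T R) (E : set T) :
    set T -> \bar R :=
  fun B => (P (B `&` E) * ((fine (P E))^-1)%:E)%E.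

(* The particles solve the ODE classically away from the jump times of i, at
   which a two-sided derivative need not exist, and are continuous across
   them. *)
Definition subsampling_TEKI_solution (R : realType) (d : measure_display)
    (T : measurableType d) (P : probability T R) (n N Nsub : nat)
    (Phi : 'I_Nsub -> 'cV[R]_n -> R) (i : R -> T -> 'I_Nsub)
    (theta0 : 'I_N -> 'cV[R]_n) (theta : R -> 'I_N -> T -> borel_cV R n) :
    Prop :=
  (forall (t : R) j, 0 <= t -> measurable_fun setT (theta t j)) /\
  {ae P, forall w,
    let x : R -> 'I_N -> 'cV[R]_n := fun t j => theta t j w in
    [/\ x 0 = theta0,
        forall j, {within `[0, +oo[, continuous (x ^~ j)} &
        forall t : R, 0 < t -> (\forall s \near t, i s w = i t w) ->
        forall j, is_derive t 1 (x ^~ j)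
          (- (ens_cov (x t) *m grad (Phi (i t w)) (x t j)))]}.

(* Main.v *)
Require Import Defs.
From HB Require Import structures.
From mathcomp Require Import all_boot all_order all_algebra.
From mathcomp Require Import all_classical all_reals all_analysis.
From mathcomp Require Import measurable_realfun.
From mathcomp Require Import ring lra.
From mathcomp Require complex.

Set Implicit Arguments.
Unset Strict Implicit.
Unset Printing Implicit Defensive.

Import Order.TTheory GRing.Theory Num.Theory.
Import numFieldNormedType.Exports.

Local Open Scope classical_set_scope.
Local Open Scope ring_scope.

(** Fix a path of the index process. Let e_l be the deviation of particle l
from the ensemble mean, C the empirical covariance, H_a the Hessian of the
a-th potential (sub_hess) and gam_a its gradient at the optimum z. Then
e_l' = - C H_i e_l, and the error r = theta_j - z satisfies
r' = - C (H_i r + gam_i). The index noise acts only through gam_i, and it is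
damped because C collapses like 1/t. The proof makes this quantitative.

Collapse. For a fixed vector u, the variance <u, C u> has derivative
- 2 <C u, H_i C u>. Tikhonov regularisation makes every H_a coercive, so for a
unit vector this is a Riccati inequality v' <= - 2 lam v^2, and v = O(1/(1+t)).
Hence e_l = O((1+t)^(-1/2)) and e_l' = O((1+t)^(-3/2)), with constants that
depend on the initial ensemble only (deviation_decay, velocity_decay). The
variance in a direction u is nonincreasing, so a direction without spread at
time 0 never acquires any: the e_l stay in the initial span. By optimality of z
the sum of all the gam_a is orthogonal to that span.

Linear representation. The forcing - C gam_i is a combination of the e_l, and
the e_l solve the homogeneous equation. Variation of constants therefore gives
r = sum_l c_l e_l with scalar coefficients, c_l' = - <gam_i, e_l> / (N - 1)
(ensemble_coordinates).

Averaging. Since the <gam_a, e_l> add up to zero over a, the coefficient c_l is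
an integral against the centred occupation times of the states. Summation by
parts moves the derivative to e_l (path_estimate). The rates of the index
process are bounded below, so its correlations decay exponentially
(transition_decay) and the centred occupation up to time s is O(sqrt s) in mean
(csum_first_moment). Weighted with (1+s)^(-3/2), this integrates to a
logarithm: the c_l are O(1 + ln (1+t)) in mean, and r is
O((1+t)^(-1/2) (1 + ln (1+t))) in mean (mean_error_decay).

Integrals over time are replaced by sums on a grid of mesh t/m, so that
expectations only involve finitely many times. The error vanishes pathwise as m
grows, because a cadlag path with values in a finite set has finitely many
jumps in bounded time; dominated convergence removes the grid.

Wasserstein distance. The joint law of the constant z and of theta_j under the
conditional probability is a coupling, and conditioning on a state of the
uniform initial law multiplies expectations of nonnegative variables by at most
the number of states (wasserstein_dirac_le). *)

(** * Functions that are differentiable off a locally finite set *)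

(** The interval [a, b] is handled by the supremum of the times reachable from a.
The last two hypotheses let the property start and stop at any time, the first
one glues. *)
Lemma interval_induction (R : realType) (Q : R -> R -> Prop) (a b : R) :
  a < b ->
  (forall u v w, a <= u -> u < v -> v < w -> w <= b -> Q u v -> Q v w -> Q u w) ->
  (forall t, a <= t -> t < b -> \forall v \near t^'+, Q t v) ->
  (forall t, a < t -> t <= b -> \forall u \near t^'-, Q u t) ->
  Q a b.
Proof.
move=> ab Qtrans Qright Qleft.
pose S := [set v | a < v <= b /\ Q a v].
have [c [Sc cb]] : exists c, S c /\ c <= b.
  near a^'+ => c; exists c; split; last by near: c; apply: nbhs_right_le.
  split; last by near: c; apply: Qright.
  by apply/andP; split; near: c; [exact: nbhs_right_gt|exact: nbhs_right_le].
have supS : has_sup S.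
  by split; [exists c|exists b => v [/andP[]]].
set s := sup S.
have cs : c <= s by apply: ub_le_sup => //; case: supS.
have as_ : a < s by case: Sc => /andP[ac _] _; exact: lt_le_trans cs.
have sb : s <= b by apply: ge_sup => //; [exists c|move=> v [/andP[]]].
have Qs : Q a s.
  have /Qleft := as_ => /(_ sb) => -[e /= e0 He].
  have [v Sv sv] := sup_adherent e0 supS.
  have vs : v <= s by apply: ub_le_sup => //; case: supS.
  move: vs; rewrite le_eqVlt => /predU1P[<-|vs]; first by case: Sv.
  case: Sv => /andP[av vb] Qav; apply: (Qtrans a v s) => //.
  apply: He => //=; rewrite ger0_norm ?subr_ge0 1?ltW//.
  by rewrite ltrBlDl -ltrBlDr.
move: sb; rewrite le_eqVlt => /predU1P[<-//|sb].
exfalso.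
near s^'+ => w.
have sw : s < w by near: w; exact: nbhs_right_gt.
have wb : w <= b by near: w; exact: nbhs_right_le.
have : S w.
  split; first by rewrite wb (lt_trans as_).
  apply: (Qtrans a s w) => //.
  by near: w; apply: Qright => //; exact: ltW.
move=> /(ub_le_sup supS.2).
by rewrite leNgt sw.
Unshelve. all: by end_near. Qed.

(** The complement of reg has no accumulation point in the half-line, from either
side. For a path of the index process, reg is the set of non-jump times. *)
Definition piecewise (R : realType) (reg : set R) :=
  (forall t : R, 0 <= t -> \forall s \near t^'+, reg s) /\
  (forall t : R, 0 < t -> \forall s \near t^'-, reg s).

Section Piecewise.
Variables (R : realType) (reg : set R).
Hypothesis regP : piecewise reg.
Implicit Types (f df : R -> R) (a b : R).

(** A property of intervals that is additive and holds between consecutive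
exceptional times holds on every interval. *)
Lemma piecewise_interval_induction (Q : R -> R -> Prop) a b : 0 <= a -> a < b ->
  (forall u v w, a <= u -> u < v -> v < w -> w <= b -> Q u v -> Q v w -> Q u w) ->
  (forall u v, a <= u -> u < v -> v <= b -> `]u, v[ `<=` reg -> Q u v) ->
  Q a b.
Proof.
move=> a0 ab Qtrans Qreg; apply: interval_induction => // t ta tb.
- have [e /= e0 He] := regP.1 t (le_trans a0 ta).
  near=> v; apply: Qreg => //.
    by near: v; exact: nbhs_right_le.
  move=> s /=; rewrite in_itv/= => /andP[ts sv]; apply: He => //=.
  rewrite distrC gtr0_norm ?subr_gt0// ltrBlDl (lt_trans sv)//.
  by near: v; apply: nbhs_right_lt; rewrite ltrDl.
- have [e /= e0 He] := regP.2 t (le_lt_trans a0 ta).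
  near=> v; apply: Qreg => //.
    by near: v; exact: nbhs_left_ge.
  move=> s /=; rewrite in_itv/= => /andP[ts sv]; apply: He => //=.
  rewrite gtr0_norm ?subr_gt0// ltrBlDr -ltrBlDl (lt_trans _ ts)//.
  by near: v; apply: nbhs_left_gt; rewrite ltrBlDr ltrDl.
Unshelve. all: by end_near. Qed.

Lemma piecewise_nonincreasing f df a b : 0 <= a -> a <= b ->
  continuous f ->
  (forall t, a < t < b -> reg t -> is_derive t 1 f (df t)) ->
  (forall t, a < t < b -> reg t -> df t <= 0) ->
  f b <= f a.
Proof.
move=> a0; rewrite le_eqVlt => /predU1P[->//|ab] cf fdf df0.
pose Q u v := f v <= f u.
apply: (@piecewise_interval_induction Q a b) => //.
  by move=> u v w _ _ _ _ uv vw; exact: (le_trans vw uv).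
move=> u v au uv vb uvreg.
have sub t : t \in `]u, v[ -> a < t < b /\ reg t.
  move=> tuv; split; last exact: uvreg.
  move: tuv; rewrite in_itv/= => /andP[ut tv].
  by rewrite (le_lt_trans au ut) (lt_le_trans tv vb).
apply: (@ler0_derive1_le_cc _ f u v) => //.
- by move=> t /sub [? /fdf]; case.
- by move=> t /sub [? rt]; rewrite derive1E (@derive_val _ _ _ _ _ _ _ (fdf _ _ rt))// df0.
- exact: continuous_subspaceT.
- by rewrite bound_itvE ltW.
- by rewrite bound_itvE ltW.
- exact: ltW.
Qed.

(** Replaces the mean value inequality across the jumps of the index process. *)
Lemma piecewise_lipschitz f df a b (B : R) : 0 <= a -> a <= b ->
  continuous f ->
  (forall t, a < t < b -> reg t -> is_derive t 1 f (df t)) ->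
  (forall t, a < t < b -> reg t -> `|df t| <= B) ->
  `|f b - f a| <= B * (b - a).
Proof.
move=> a0 ab cf fdf dfB; rewrite ler_norml; apply/andP; split.
- rewrite -subr_ge0 opprK.
  pose g t := - f t - B * t.
  suff : g b <= g a by rewrite /g; nra.
  apply: (@piecewise_nonincreasing g (fun t => - df t - B * 1) a b) => //.
  + by move=> t; apply: cvgB; [apply: cvgN; exact: cf|apply: cvgM; [exact: cvg_cst|exact: cvg_id]].
  + move=> t tab rt; have := fdf t tab rt => ?.
    by apply: is_deriveB.
  + by move=> t tab rt; have := dfB t tab rt; rewrite ler_norml; lra.
- rewrite -subr_ge0.
  pose g t := f t - B * t.
  suff : g b <= g a by rewrite /g; nra.
  apply: (@piecewise_nonincreasing g (fun t => df t - B * 1) a b) => //.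
  + by move=> t; apply: cvgB; [exact: cf|apply: cvgM; [exact: cvg_cst|exact: cvg_id]].
  + move=> t tab rt; have := fdf t tab rt => ?.
    by apply: is_deriveB.
  + by move=> t tab rt; have := dfB t tab rt; rewrite ler_norml; lra.
Qed.

End Piecewise.

(** * Square roots of positive definite matrices *)

(** Lagrange interpolation by induction on the nodes: the product of the previous
linear factors corrects the value at the new node. *)
Lemma poly_interpolation (F : fieldType) (f : F -> F) (s : seq F) :
  exists p : {poly F}, forall x, x \in s -> p.[x] = f x.
Proof.
elim: s => [|a s [p IH]]; first by exists 0.
case: (boolP (a \in s)) => [as_|nas].
  by exists p => x; rewrite inE => /orP[/eqP->|]; exact: IH.
pose w := \prod_(z <- s) ('X - z%:P).
have wa : w.[a] != 0.
  by rewrite -rootE root_prod_XsubC.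
exists (p + ((f a - p.[a]) / w.[a])%:P * w) => x.
rewrite inE hornerD hornerM hornerC => /orP[/eqP->|xs].
  by rewrite divfK// addrC subrK.
by rewrite (_ : w.[x] = 0) ?mulr0 ?addr0 ?IH//; apply/eqP; rewrite -rootE root_prod_XsubC.
Qed.

Section SquareRoot.
Variable R : realType.
Import complex.
Local Notation rc := (real_complex R).

Lemma posdefmx_eigenvalue_gt0 n (M : 'M[R]_n) a :
  posdefmx M -> eigenvalue M a -> 0 < a.
Proof.
move=> [_ Mpos] /eigenvalueP[v vM v0].
have v0' : v^T != 0 by rewrite -(inj_eq trmx_inj) trmxK trmx0.
have := Mpos _ v0'; rewrite trmxK vM -scalemxAl mxE => avv.
have vv : 0 <= (v *m v^T) 0 0.
  by rewrite mxE; apply: sumr_ge0 => k _; rewrite mxE -expr2 sqr_ge0.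
by rewrite ltNge; apply/negP => a0; move: avv; rewrite ltNge mulr_le0_ge0.
Qed.

(** The spectral theorem over the complex numbers diagonalises M with real positive
eigenvalues, so a real polynomial that vanishes at them annihilates M. *)
Lemma posdefmx_annihilated n (M : 'M[R]_n.+1) : posdefmx M ->
  exists s : seq R, (forall a, a \in s -> 0 < a) /\
    forall p : {poly R}, (forall a, a \in s -> p.[a] = 0) -> horner_mx M p = 0.
Proof.
move=> Mpos; have [Msym _] := Mpos.
pose Mc := map_mx rc M.
have Mherm : Mc \is hermsymmx.
  apply/is_hermitianmxP; rewrite expr0 scale1r.
  apply/matrixP => i j; rewrite !mxE.
  have -> : M j i = M i j by rewrite -[in LHS]Msym mxE.
  by apply/esym/conjc_real.
have /orthomx_spectralP := hermitian_normalmx Mherm.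
set P := spectralmx Mc; set d := spectral_diag Mc => McE.
have Pu : P \in unitmx := spectral_unit _.
have dreal k : d 0 k = rc (Re (d 0 k)).
  have /mxOverP/(_ 0 k) := hermitian_spectral_diag_real Mherm.
  rewrite -/d; case: (d 0 k) => x y /=.
  by rewrite realE !lecE /= => /orP[/andP[/eqP]|/andP[/eqP]] => [->|<-].
exists [seq Re (d 0 k) | k <- enum 'I_n.+1]; split.
  move=> a /mapP[k _ ->]; apply: (posdefmx_eigenvalue_gt0 Mpos).
  rewrite eigenvalue_root_char -(fmorph_root (real_complex R)) map_char_poly.
  rewrite -/Mc -eigenvalue_root_char; apply/eigenvalueP; exists (row k P).
    rewrite McE !mulmxA -!row_mul mulmxV// row_mul mul1mx -row_mul.
    by apply/rowP => j; rewrite row_mul row_diag_mx -scalemxAl -rowE !mxE [X in X * _]dreal.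
  apply/eqP => rk0; have : row k P *m invmx P = 0 by rewrite rk0 mul0mx.
  rewrite -row_mul mulmxV// => /rowP/(_ k); rewrite !mxE eqxx => /eqP.
  by rewrite oner_eq0.
move=> p p0; apply: (map_mx_inj (f := real_complex R)).
rewrite map_horner_mx map_mx0 -/Mc McE.
rewrite horner_mx_uconjC// horner_mx_diag.
have -> : map_mx (horner (map_poly (real_complex R) p)) d = 0.
  apply/rowP => k; rewrite !mxE dreal horner_map p0 ?rmorph0//.
  by apply/mapP; exists k => //; rewrite mem_enum.
by rewrite linear0 mulmx0 mul0mx.
Qed.

Lemma tr_horner_mx n (M : 'M[R]_n.+1) p : M^T = M -> (horner_mx M p)^T = horner_mx M p.
Proof.
move=> Msym.
elim/poly_ind: p => [|p c IH]; first by rewrite rmorph0 trmx0.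
rewrite rmorphD rmorphM /= horner_mx_X horner_mx_C linearD /= tr_scalar_mx.
rewrite trmx_mul Msym IH; congr (_ + _).
exact: (comm_mx_horner p (comm_mx_refl M)).
Qed.

(** The root is q(M)^2, where q interpolates the fourth root on the eigenvalues. The
fourth root rather than the square root makes semidefiniteness immediate, since
the square of a symmetric matrix is semidefinite. *)
Lemma posdefmx_has_root n (M : 'M[R]_n) : posdefmx M ->
  exists S, possemidefmx S /\ S *m S = M.
Proof.
case: n M => [|n] M Mpos.
  exists M; split; last by apply/matrixP => -[].
  by split=> [|v]; [case: Mpos|rewrite (_ : _ *m v = 0) ?mxE// thinmx0 ?mul0mx// flatmx0 mulmx0].
have [s [s0 sann]] := posdefmx_annihilated Mpos.
have [Msym _] := Mpos.
have [q qE] := poly_interpolation (fun x => Num.sqrt (Num.sqrt x)) s.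
have q4 : horner_mx M (q ^+ 4) = M.
  apply/eqP; rewrite -subr_eq0 -[X in _ - X]horner_mx_X -rmorphB /=.
  apply/eqP/sann => a as_; rewrite hornerD hornerN hornerX horner_exp qE//.
  by rewrite (exprM _ 2 2) !sqr_sqrtr ?sqrtr_ge0 ?ltW ?s0 ?subrr.
exists (horner_mx M q *m horner_mx M q); split; first split.
- by rewrite trmx_mul tr_horner_mx.
- move=> v; set h := horner_mx M q.
  have -> : v^T *m (h *m h) *m v = (h *m v)^T *m (h *m v).
    by rewrite trmx_mul tr_horner_mx// !mulmxA.
  by rewrite mxE; apply: sumr_ge0 => k _; rewrite mxE -expr2 sqr_ge0.
- rewrite -[RHS]q4 !mulmxE -!rmorphM; congr (horner_mx M _).
  by rewrite -expr2 -expr2 -exprM.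
Qed.

Lemma sqrtmxK n (M : 'M[R]_n) : posdefmx M -> (sqrtmx M)^T *m sqrtmx M = M.
Proof.
move=> /posdefmx_has_root rootM.
by have [[Ssym _] SS] := xgetPex 0 rootM; rewrite /sqrtmx Ssym.
Qed.

End SquareRoot.

(** * Gradients and optimality for the regularised misfit *)

Section Misfit.
Variable R : realType.

Lemma enorm_sqr n (x : 'cV[R]_n) : enorm x ^+ 2 = (x^T *m x) 0 0.
Proof.
rewrite /enorm sqr_sqrtr; last by apply: sumr_ge0 => k _; rewrite sqr_ge0.
by rewrite mxE; apply: eq_bigr => k _; rewrite mxE expr2.
Qed.

Lemma misfitD m n (A : 'M[R]_(m, n)) y x v :
  misfit A y (x + v) = misfit A y x + (v^T *m (A^T *m (A *m x - y))) 0 0 +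
    2^-1 * ((A *m v)^T *m (A *m v)) 0 0.
Proof.
rewrite /misfit !enorm_sqr; set r := y - A *m x; set w := A *m v.
have -> : y - A *m (x + v) = r - w by rewrite mulmxDr opprD addrA.
have -> : v^T *m (A^T *m (A *m x - y)) = - (w^T *m r).
  by rewrite -[A *m x - y]opprB -/r mulmxA -trmx_mul -/w mulmxN.
have rw : (r^T *m w) 0 0 = (w^T *m r) 0 0.
  by rewrite -[in RHS](trmxK r) -trmx_mul [in RHS]mxE.
have -> : (r - w)^T *m (r - w) =
    r^T *m r - w^T *m r - (r^T *m w - w^T *m w).
  by rewrite mulmxBr [(r - w)^T]linearB /= !mulmxBl.
have mxB (B C : 'M[R]_1) : (B - C) 0 0 = B 0 0 - C 0 0 by rewrite !mxE.
have mxN (B : 'M[R]_1) : (- B) 0 0 = - B 0 0 by rewrite !mxE.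
by rewrite !mxB mxN rw; lra.
Qed.

(** The misfit is quadratic along lines; both its gradient and the first-order
optimality condition are read off from this expansion. *)
Lemma misfit_line m n (A : 'M[R]_(m, n)) y x v s :
  misfit A y (x + s *: v) = misfit A y x +
    s * (v^T *m (A^T *m (A *m x - y))) 0 0 +
    2^-1 * s ^+ 2 * ((A *m v)^T *m (A *m v)) 0 0.
Proof.
rewrite misfitD; set g := A^T *m _; set w := A *m v.
have -> : (s *: v)^T *m g = s *: (v^T *m g) by rewrite [(s *: v)^T]linearZ /= -scalemxAl.
have -> : A *m (s *: v) = s *: w by rewrite -scalemxAr.
have -> : (s *: w)^T *m (s *: w) = s ^+ 2 *: (w^T *m w).
  by rewrite [(s *: w)^T]linearZ /= -scalemxAl -scalemxAr scalerA.
have mxZ c (B : 'M[R]_1) : (c *: B) 0 0 = c * B 0 0 by rewrite !mxE.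
by rewrite !mxZ; ring.
Qed.

Lemma grad_misfit m n (A : 'M[R]_(m, n)) y x :
  grad (misfit A y) x = A^T *m (A *m x - y).
Proof.
apply/colP => k; rewrite mxE.
set d := delta_mx k 0; set g := A^T *m _.
have gk : (d^T *m g) 0 0 = g k 0.
  by rewrite trmx_delta -rowE mxE.
rewrite -gk; apply: cvg_lim => //.
pose b := 2^-1 * ((A *m d)^T *m (A *m d)) 0 0.
suff : (d^T *m g) 0 0 + h * b @[h --> 0^'] --> (d^T *m g) 0 0 + 0 * b.
  rewrite mul0r addr0; apply: cvg_trans; apply: near_eq_cvg.
  near=> h.
  have h0 : h != 0 by near: h; exact: nbhs_dnbhs_neq.
  rewrite /= [h *: d + x]addrC misfit_line -/g /b.
  set p := (d^T *m g) 0 0; set q := ((A *m d)^T *m _) 0 0.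
  rewrite /GRing.scale /=.
  by field.
apply: cvgD; first exact: cvg_cst.
apply: cvgM; last exact: cvg_cst.
exact: cvg_within.
Unshelve. all: by end_near. Qed.

(** Along an admissible direction v the misfit is p s + q s^2 / 2 above its minimum.
At s = - p / (q + 1) this is negative unless p = 0. *)
Lemma argmin_misfit_orthogonal m n N (A : 'M[R]_(m, n)) y (x0 : 'I_N -> 'cV[R]_n) x (v : 'cV[R]_n) :
  argmin (ens_affine x0) (misfit A y) x -> (v^T <= ens_span x0)%MS ->
  (v^T *m (A^T *m (A *m x - y))) 0 0 = 0.
Proof.
move=> [xaff xmin] vspan.
set p := (_ *m _) 0 0; set q := ((A *m v)^T *m (A *m v)) 0 0.
have pq s : 0 <= s * p + 2^-1 * s ^+ 2 * q.
  have /xmin : ens_affine x0 (x + s *: v).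
    rewrite /ens_affine /= addrAC linearD /= addmx_sub// linearZ /=.
    exact: scalemx_sub.
  by rewrite misfit_line -/p -/q; lra.
have q0 : 0 <= q by rewrite /q -enorm_sqr sqr_ge0.
have q1 : 0 < q + 1 by lra.
have := pq (- (p / (q + 1))).
have -> : - (p / (q + 1)) * p + 2^-1 * (- (p / (q + 1))) ^+ 2 * q =
  - (p / (q + 1)) ^+ 2 * (q / 2 + 1) by field; rewrite gt_eqF.
rewrite mulNr oppr_ge0 => H.
have : (p / (q + 1)) ^+ 2 * (q / 2 + 1) = 0.
  by apply/eqP; rewrite eq_le H mulr_ge0 ?sqr_ge0//; lra.
move/eqP; rewrite mulf_eq0 sqrf_eq0 mulf_eq0 invr_eq0 (gt_eqF q1) orbF.
by rewrite [X in _ || X]gt_eqF ?orbF => [/eqP//|]; lra.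
Qed.

Section Regularised.
Variables (n Nsub : nat) (k : 'I_Nsub -> nat).
Variables (A : forall i, 'M[R]_(k i, n)) (y : forall i, 'cV[R]_(k i)).
Variables (alpha : R) (C0 : 'M[R]_n).
Hypotheses (alpha0 : 0 < alpha) (C0pos : posdefmx C0) (Nsub0 : (0 < Nsub)%N).

Definition sub_hess i : 'M[R]_n := (A i)^T *m A i + (alpha / Nsub%:R) *: C0.

(** The gradient of the a-th regularised potential, see grad_Phi_reg_sub. *)
Definition sub_grad i (x : 'cV[R]_n) := sub_hess i *m x - (A i)^T *m y i.

Lemma posdefmxZ a (M : 'M[R]_n) : 0 < a -> posdefmx M -> posdefmx (a *: M).
Proof.
move=> a0 [Msym Mpos]; split; first by rewrite linearZ /= Msym.
by move=> v v0; rewrite -scalemxAr -scalemxAl mxE mulr_gt0// Mpos.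
Qed.

(** The square root of M disappears from the normal equations. *)
Lemma reg_normal m (B : 'M[R]_(m, n)) (z : 'cV[R]_m) (M : 'M[R]_n) x :
  posdefmx M ->
  (reg_op B M)^T *m (reg_op B M *m x - reg_data n z) =
  (B^T *m B + M) *m x - B^T *m z.
Proof.
move=> Mpos; rewrite /reg_op /reg_data mulmxBr mulmxA tr_col_mx !mul_row_col.
by rewrite sqrtmxK// mulmx0 addr0.
Qed.

Let alphaN0 : 0 < alpha / Nsub%:R.
Proof. by rewrite divr_gt0// ltr0n. Qed.

Lemma grad_Phi_reg_sub i x : grad (Phi_reg_sub A y alpha C0 i) x = sub_grad i x.
Proof. by rewrite grad_misfit reg_normal//; exact: posdefmxZ. Qed.

(** The potentials of the subsets add up to the full potential, so their gradients
at the constrained optimum cancel on the span of the ensemble. *)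
Lemma sum_sub_grad_orthogonal N (x0 : 'I_N -> 'cV[R]_n) x (v : 'cV[R]_n) :
  argmin (ens_affine x0) (Phi_reg A y alpha C0) x -> (v^T <= ens_span x0)%MS ->
  (v^T *m \sum_i sub_grad i x) 0 0 = 0.
Proof.
move=> /argmin_misfit_orthogonal xmin /xmin {xmin}.
rewrite reg_normal; last exact: posdefmxZ.
rewrite !tr_mxcol !mul_mxrow_mxcol => <-; congr ((_ *m _) 0 0).
rewrite /sub_grad /sub_hess sumrB -mulmx_suml big_split /=.
rewrite sumr_const card_ord -scaler_nat scalerA mulrCA divff ?mulr1//.
by rewrite pnatr_eq0 -lt0n.
Qed.

Lemma sub_hess_sym i : (sub_hess i)^T = sub_hess i.
Proof.
rewrite /sub_hess linearD /= trmx_mul trmxK linearZ /=.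
by case: C0pos => ->.
Qed.

End Regularised.
End Misfit.

(** * Dot products, sup norms and derivatives of vector-valued functions *)

Section Dot.
Variable R : realType.

Definition dotp n (u v : 'cV[R]_n) : R := (u^T *m v) 0 0.

Lemma dotpE n (u v : 'cV[R]_n) : dotp u v = \sum_k u k 0 * v k 0.
Proof. by rewrite /dotp mxE; apply: eq_bigr => k _; rewrite mxE. Qed.

Lemma dotpC n (u v : 'cV[R]_n) : dotp u v = dotp v u.
Proof. by rewrite !dotpE; apply: eq_bigr => k _; rewrite mulrC. Qed.

Lemma dotpDr n (u v w : 'cV[R]_n) : dotp u (v + w) = dotp u v + dotp u w.
Proof. by rewrite /dotp mulmxDr mxE. Qed.

Lemma dotpZr n a (u v : 'cV[R]_n) : dotp u (a *: v) = a * dotp u v.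
Proof. by rewrite /dotp -scalemxAr mxE. Qed.

Lemma dotpNr n (u v : 'cV[R]_n) : dotp u (- v) = - dotp u v.
Proof. by rewrite /dotp mulmxN mxE. Qed.

Lemma dotp0r n (u : 'cV[R]_n) : dotp u 0 = 0.
Proof. by rewrite /dotp mulmx0 mxE. Qed.

Lemma dotp_sumr n (I : Type) (r : seq I) P (u : 'cV[R]_n) (F : I -> 'cV[R]_n) :
  dotp u (\sum_(i <- r | P i) F i) = \sum_(i <- r | P i) dotp u (F i).
Proof. by apply: (big_morph (dotp u)); [exact: dotpDr|exact: dotp0r]. Qed.

Lemma dotp_mulmxr m n (u : 'cV[R]_m) (A : 'M[R]_(m, n)) (v : 'cV[R]_n) :
  dotp u (A *m v) = dotp (A^T *m u) v.
Proof. by rewrite /dotp trmx_mul trmxK mulmxA. Qed.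

Lemma dotp_delta n (p : 'I_n) (v : 'cV[R]_n) : dotp (delta_mx p 0) v = v p 0.
Proof. by rewrite /dotp trmx_delta -rowE mxE. Qed.

Lemma dotp_self n (u : 'cV[R]_n) : dotp u u = \sum_k u k 0 ^+ 2.
Proof. by rewrite dotpE; apply: eq_bigr => k _; rewrite expr2. Qed.

Lemma dotp_self_ge0 n (u : 'cV[R]_n) : 0 <= dotp u u.
Proof. by rewrite dotp_self; apply: sumr_ge0 => k _; exact: sqr_ge0. Qed.

Lemma ler_entry m n (A : 'M[R]_(m, n)) i j : `|A i j| <= `|A|.
Proof.
rewrite [leRHS]mx_normrE.
by rewrite (le_bigmax _ (fun ij : 'I_m * 'I_n => `|A ij.1 ij.2|) (i, j)).
Qed.

Lemma mx_norm_le m n (A : 'M[R]_(m, n)) B :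
  0 <= B -> (forall i j, `|A i j| <= B) -> `|A| <= B.
Proof.
move=> B0 AB; rewrite [leLHS]mx_normrE.
by apply/bigmax_leP; split => // -[i j] _ /=; exact: AB.
Qed.

Lemma ler_norm_mulmx m n p (A : 'M[R]_(m, n)) (B : 'M[R]_(n, p)) :
  `|A *m B| <= n%:R * (`|A| * `|B|).
Proof.
apply: mx_norm_le => [|i j]; first by rewrite !mulr_ge0.
rewrite mxE (le_trans (ler_norm_sum _ _ _))//.
rewrite -[n in n%:R]card_ord mulr_natl -sumr_const ler_sum// => k _.
by rewrite normrM ler_pM// ler_entry.
Qed.

Lemma norm_tr m n (A : 'M[R]_(m, n)) : `|A^T| = `|A|.
Proof.
have le_tr p q (B : 'M[R]_(p, q)) : `|B^T| <= `|B|.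
  by apply: mx_norm_le => // i j; rewrite mxE ler_entry.
by apply/eqP; rewrite eq_le le_tr -[in leLHS](trmxK A) le_tr.
Qed.

Lemma ler_dotp n (u v : 'cV[R]_n) : `|dotp u v| <= n%:R * (`|u| * `|v|).
Proof. by rewrite -(norm_tr u); apply: le_trans (ler_norm_mulmx _ _); exact: ler_entry. Qed.

Lemma sqr_norm_le_dotp n (u : 'cV[R]_n) : `|u| ^+ 2 <= dotp u u.
Proof.
have s0 := dotp_self_ge0 u.
rewrite -[leRHS]sqr_sqrtr// ler_pXn2r ?nnegrE ?sqrtr_ge0//.
apply: mx_norm_le => [|i j]; first exact: sqrtr_ge0.
rewrite ord1 -sqrtr_sqr ler_wsqrtr// dotp_self (bigD1 i)//= lerDl.
by apply: sumr_ge0 => k _; exact: sqr_ge0.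
Qed.

Lemma posdefmx_unit n (M : 'M[R]_n) : posdefmx M -> M \in unitmx.
Proof.
move=> [_ Mpos]; rewrite -row_free_unit -kermx_eq0; apply/rowV0P => v.
move=> /sub_kermxP vM; apply/eqP/negP => /negP v0.
have v0' : v^T != 0 by rewrite -(inj_eq trmx_inj) trmxK trmx0.
by have := Mpos _ v0'; rewrite trmxK vM mul0mx mxE ltxx.
Qed.

(** With M = S^T S and S invertible, |v| is at most a multiple of |S v|. *)
Lemma posdefmx_coercive n (M : 'M[R]_n) : posdefmx M ->
  exists2 lam, 0 < lam & forall v, lam * `|v| ^+ 2 <= dotp v (M *m v).
Proof.
move=> Mpos; set S := sqrtmx M.
have SM : S^T *m S = M := sqrtmxK Mpos.
have Su : S \in unitmx.
  by have := posdefmx_unit Mpos; rewrite -SM unitmx_mul => /andP[].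
pose k : R := n%:R * `|invmx S|.
have k0 : 0 <= k by rewrite mulr_ge0.
exists ((k ^+ 2 + 1)^-1) => [|v]; first by rewrite invr_gt0 ltr_pwDr// sqr_ge0.
rewrite -SM -mulmxA dotp_mulmxr trmxK.
rewrite ler_pdivrMl ?ltr_pwDr ?sqr_ge0//.
have vS : `|v| <= k * `|S *m v|.
  by rewrite -{1}(mulKmx Su v) (le_trans (ler_norm_mulmx _ _))// /k mulrA.
have := sqr_norm_le_dotp (S *m v); set d := dotp _ _ => Sd.
apply: (@le_trans _ _ ((k * `|S *m v|) ^+ 2)); first by rewrite ler_pXn2r ?nnegrE ?mulr_ge0.
rewrite exprMn; have := sqr_ge0 k; have := sqr_ge0 `|S *m v|; nra.
Qed.

End Dot.

Section DeriveVector.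
Variables (R : realType) (n : nat).

Lemma is_deriveP (V : normedModType R) (f : R -> V) (t : R) df :
  is_derive t 1 f df <-> h^-1 *: (f (h + t) - f t) @[h --> 0^'] --> df.
Proof.
have E : (fun h : R => h^-1 *: (f (h + t) - f t)) =
         (fun h : R => h^-1 *: ((f \o shift t) (h *: (1 : R)) - f t)).
  by apply/funext => h; rewrite /= /GRing.scale /= mulr1.
rewrite E; split.
  by case=> df1 <-.
by move=> fdf; split; [apply/cvg_ex; exists df|exact: cvg_lim].
Qed.

Lemma is_derive_near (V : normedModType R) (f g : R -> V) (t : R) df :
  (\forall s \near t, f s = g s) -> is_derive t 1 f df -> is_derive t 1 g df.
Proof.
move=> fg /is_deriveP fdf; apply/is_deriveP; apply: cvg_trans fdf.
apply: near_eq_cvg; near=> h.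
rewrite (nbhs_singleton fg); congr (_ *: (_ - _)).
near: h; apply: nbhs_dnbhs.
have ht : h + t @[h --> (0 : R)] --> t.
  by rewrite -[X in _ --> X]add0r; apply: cvgD; [exact: cvg_id|exact: cvg_cst].
exact: (ht _ fg).
Unshelve. all: by end_near. Qed.

Lemma is_derive_coord m (f : R -> 'M[R]_(m, n)) (t : R) df p q :
  is_derive t 1 f df -> is_derive t 1 (fun s => f s p q) (df p q).
Proof.
move=> /is_deriveP fdf; apply/is_deriveP.
rewrite [X in X @ _ --> _](_ : _ =
  (fun M : 'M[R]_(m, n) => M p q) \o (fun h => h^-1 *: (f (h + t) - f t))).
  by apply: cvg_comp fdf _; exact: coord_continuous.
by apply/funext => h /=; rewrite !mxE.
Qed.

Lemma continuous_coord (T : topologicalType) m (f : T -> 'M[R]_(m, n)) p q :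
  continuous f -> continuous (fun s => f s p q).
Proof.
move=> cf t; apply: (@cvg_comp _ _ _ f (fun M : 'M[R]_(m, n) => M p q)); first exact: cf.
exact: coord_continuous.
Qed.

End DeriveVector.

Section DeriveDot.
Variables (R : realType) (n : nat).

Lemma is_derive_dotp (u : 'cV[R]_n) (f : R -> 'cV[R]_n) (t : R) df :
  is_derive t 1 f df -> is_derive t 1 (fun s => dotp u (f s)) (dotp u df).
Proof.
move=> fdf; rewrite dotpE.
rewrite (_ : (fun _ => _) = \sum_k (fun s => u k 0 * f s k 0)).
  apply: is_derive_sum => k.
  exact: (@is_deriveZ _ _ _ (fun s => f s k 0) (u k 0) _ _ _ (is_derive_coord k 0 fdf)).
by apply/funext => s; rewrite dotpE fct_sumE.
Qed.

Lemma continuous_sum (V : normedModType R) (T : topologicalType) (I : Type)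
    (r : seq I) (P : pred I) (F : I -> T -> V) :
  (forall i, P i -> continuous (F i)) ->
  continuous (fun s => \sum_(i <- r | P i) F i s).
Proof. by apply: continuous_big; exact: add_continuous. Qed.

Lemma continuous_dotp (T : topologicalType) (u : 'cV[R]_n) (f : T -> 'cV[R]_n) :
  continuous f -> continuous (fun s => dotp u (f s)).
Proof.
move=> cf; rewrite (_ : (fun _ => _) = fun s => \sum_k (u k 0 * f s k 0)); last first.
  by apply/funext => s; rewrite dotpE.
apply: continuous_sum => k _ t; apply: cvgM; first exact: cvg_cst.
exact: continuous_coord.
Qed.

End DeriveDot.

(** * Cadlag paths with finitely many states *)

(** Turns continuity on a closed half-line or segment into continuity on the whole
line, by composing with the retraction. *)
Lemma continuous_comp_within (U : topologicalType) (V : topologicalType) (W : topologicalType)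
    (A : set V) (g : V -> W) (h : U -> V) :
  {within A, continuous g} -> continuous h -> (forall s, A (h s)) ->
  continuous (fun s => g (h s)).
Proof.
move=> /subspace_continuousP gA ch hA s B /= gB.
have H : nbhs (h s) [set y | A y -> B (g y)] := gA (h s) (hA s) B gB.
have : nbhs s [set r | A (h r) -> B (g (h r))] := ch s _ H.
rewrite nbhs_simpl /=; apply: (@filterS _ (nbhs s)) => r /=; apply; exact: hA.
Qed.

Section Cadlag.
Variables (R : realType) (n : nat) (i : R -> 'I_n).
Hypothesis cadlag : cadlag_path i.

Definition regular : set R := [set t | \forall s \near t, i s = i t].

Lemma open_const_regular u v c :
  (forall s, u < s < v -> i s = c) -> `]u, v[ `<=` regular.
Proof.
move=> uvc t tuv; rewrite /regular /=.
have : nbhs t (`]u, v[%classic : set R).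
  by apply: open_nbhs_nbhs; split => //; exact: itv_open.
move: tuv; rewrite /= in_itv/= => tuv.
by apply: filterS => s /=; rewrite in_itv/= => suv; rewrite !uvc.
Qed.

Lemma cadlag_right t : 0 <= t ->
  \forall v \near t^'+, forall s, t <= s < v -> i s = i t.
Proof.
move=> t0; have [e /= e0 He] := cadlag.1 t t0.
near=> v => s /andP[]; rewrite le_eqVlt => /predU1P[<-//|ts] sv.
apply: He => //=; rewrite distrC gtr0_norm ?subr_gt0// ltrBlDl (lt_trans sv)//.
by near: v; apply: nbhs_right_lt; rewrite ltrDl.
Unshelve. all: by end_near. Qed.

Lemma cadlag_left t : 0 < t ->
  exists c, \forall u \near t^'-, forall s, u <= s < t -> i s = c.
Proof.
move=> t0; have [c [e /= e0 He]] := cadlag.2 t t0; exists c.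
near=> u => s /andP[us st].
apply: He => //=; rewrite gtr0_norm ?subr_gt0// ltrBlDr -ltrBlDl (lt_le_trans _ us)//.
by near: u; apply: nbhs_left_gt; rewrite ltrBlDr ltrDl.
Unshelve. all: by end_near. Qed.

(** On small half-open intervals to the right and to the left of any time, a cadlag
path with finitely many values is constant. *)
Lemma cadlag_interval_induction (Q : R -> R -> Prop) a b : 0 <= a -> a < b ->
  (forall u v w, a <= u -> u < v -> v < w -> w <= b -> Q u v -> Q v w -> Q u w) ->
  (forall u v c, a <= u -> u < v -> v <= b -> (forall s, u <= s < v -> i s = c) -> Q u v) ->
  Q a b.
Proof.
move=> a0 ab Qtrans Qconst; apply: interval_induction => // t ta tb.
- near=> v; apply: (Qconst _ _ (i t)) => //.
    by near: v; exact: nbhs_right_le.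
  by near: v; apply: cadlag_right; exact: le_trans ta.
- have [c Hc] := cadlag_left (le_lt_trans a0 ta).
  near=> u; apply: (Qconst _ _ c) => //.
    by near: u; exact: nbhs_left_ge.
  by near: u.
Unshelve. all: by end_near. Qed.

Lemma cadlag_piecewise : piecewise regular.
Proof.
split => t t0.
- near (t^'+) => v.
  have Hv : forall s, t <= s < v -> i s = i t by near: v; exact: cadlag_right.
  have tv : t < v by near: v; exact: nbhs_right_gt.
  near=> s; apply: (@open_const_regular t v (i t)).
    by move=> r /andP[tr rv]; rewrite Hv// ltW.
  by rewrite /= in_itv/=; apply/andP; split; near: s; [exact: nbhs_right_gt|exact: nbhs_right_lt].
- have [c Hc] := cadlag_left t0.
  near (t^'-) => u.
  have Hu : forall s, u <= s < t -> i s = c by near: u.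
  have ut : u < t by near: u; exact: nbhs_left_lt.
  near=> s; apply: (@open_const_regular u t c).
    by move=> r /andP[ur rt]; rewrite Hu// ltW.
  by rewrite /= in_itv/=; apply/andP; split; near: s; [exact: nbhs_left_gt|exact: nbhs_left_lt].
Unshelve. all: by end_near. Qed.

Lemma cadlag_measurable a (T : R) : 0 < T ->
  measurable (`[0, T[%classic `&` [set s | i s = a] : set (measurableTypeR R)).
Proof.
move=> T0.
pose Q u v := measurable (`[u, v[%classic `&` [set s | i s = a] : set (measurableTypeR R)).
apply: (@cadlag_interval_induction Q 0 T) => //.
  move=> u v w _ uv vw _ Quv Qvw.
  rewrite /Q (_ : `[u, w[%classic = `[u, v[%classic `|` `[v, w[%classic).
    by rewrite setIUl; exact: measurableU.
  by rewrite -itv_bndbnd_setU// bnd_simp ltW.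
move=> u v c _ uv _ uvc; rewrite /Q.
have [ca|ca] := eqVneq c a.
  rewrite (_ : _ `&` _ = `[u, v[%classic)//.
  by apply/seteqP; split => s; [case|move=> suv; split => //=; rewrite (uvc s)].
rewrite (_ : _ `&` _ = set0)//.
apply/seteqP; split => s //= -[suv]; rewrite uvc//.
by move=> /eqP; rewrite (negPf ca).
Qed.

Section Primitive.
Variable psi : 'I_n -> R -> R.
Hypothesis cpsi : forall a, continuous (psi a).
Let mu := @lebesgue_measure R.
Let f s := psi (i s) s.

Let integrable_f (T : R) : 0 < T -> mu.-integrable `[0, T] (EFin \o f).
Proof.
move=> T0.
pose g s := \sum_a `|psi a s|.
have cg : continuous g.
  apply: continuous_sum => a _ s.
  by apply: cvg_comp; [exact: cpsi|exact: norm_continuous].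
have ig : mu.-integrable `[0, T] (EFin \o g).
  apply: continuous_compact_integrable; first exact: segment_compact.
  exact: continuous_subspaceT.
apply: le_integrable ig => //.
- apply/measurable_EFinP.
  pose D a := `[0, T + 1[%classic `&` [set s | i s = a].
  apply: (@eq_measurable_fun _ _ _ _ _ (fun s => \sum_a psi a s * \1_(D a) s)).
    move=> s; rewrite inE/= in_itv/= => /andP[s0 sT].
    rewrite /f (bigD1 (i s))//= big1 ?addr0.
      rewrite indicE mem_set ?mulr1//; split => //=.
      by rewrite in_itv/= s0 (le_lt_trans sT)// ltrDl.
    move=> a ais; rewrite indicE memNset ?mulr0//= => -[_] E.
    by rewrite E eqxx in ais.
  apply: measurable_sum => a; apply: measurable_funM.
    by apply: measurable_funTS; exact: continuous_measurable_fun.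
  apply: measurable_funTS; apply: measurable_indic.
  by apply: cadlag_measurable; rewrite addr_gt0.
- move=> s _ /=; rewrite lee_fin (ger0_norm (x := g s)) ?sumr_ge0//.
  by rewrite /g (bigD1 (i s))//= lerDl sumr_ge0.
Qed.

(** The Lebesgue integral of psi_(i s) (s) over [0, t]; the integrand is continuous
at every regular time, where the fundamental theorem of calculus applies. *)
Lemma cadlag_primitive : exists F : R -> R,
  [/\ continuous F, F 0 = 0 &
      forall t, 0 < t -> regular t -> is_derive t 1 F (psi (i t) t)].
Proof.
pose G x := parameterized_integral mu 0 x f.
exists (fun t => G (Num.max 0 t)); split.
- move=> t.
  pose b := Num.max 0 t + 1.
  have b0 : 0 < b by rewrite ltr_wpDl// le_max lexx.
  have tb : t < b by rewrite ltr_pwDr// le_max lexx orbT.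
  have := parameterized_integral_continuous (ltW b0) (integrable_f b0).
  rewrite -/mu => cG.
  have cl : continuous (fun s : R => Num.min b (Num.max 0 s)).
    have cmax : continuous (cst 0 \max id : R -> R^o).
      by move=> s; apply: continuous_max; [exact: cvg_cst|exact: cvg_id].
    have cmin : continuous (cst b \min (cst 0 \max id) : R -> R^o).
      by move=> s; apply: continuous_min; [exact: cvg_cst|exact: cmax].
    exact: cmin.
  have clb s : `[0, b]%classic (Num.min b (Num.max 0 s)).
    by rewrite /= in_itv/= le_min ge_min lexx (ltW b0) le_max lexx.
  have := continuous_comp_within cG cl clb => /(_ t).
  rewrite /continuous_at.
  have E s : s < b -> Num.min b (Num.max 0 s) = Num.max 0 s.
    by move=> sb; apply/min_idPr; rewrite ge_max (ltW b0) ltW.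
  rewrite -/(G _) E//; apply: cvg_trans; apply: near_eq_cvg.
  near=> s; rewrite -/(G _) E//; near: s; exact: lt_nbhsl.
- by rewrite maxxx /G /parameterized_integral set_itv1 Rintegral_set1.
- move=> t t0 rt.
  have cf : {for t, continuous f}.
    rewrite /continuous_at /f; apply: (@cvg_trans _ (psi (i t) s @[s --> t])).
      by apply: near_eq_cvg; apply: filterS rt => s /= ->.
    exact: cpsi.
  have t1 : t < t + 1 by rewrite ltrDl.
  have [G1 G2] := continuous_FTC1_closed t1 (integrable_f (lt_trans t0 t1)) t0 cf.
  apply: (@is_derive_near _ _ G).
    near=> s; rewrite (_ : Num.max 0 s = s)//; apply/max_idPr; rewrite ltW//.
    by near: s; exact: lt_nbhsr.
  by apply: DeriveDef; [exact: G1|rewrite -derive1E G2].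
Unshelve. all: by end_near. Qed.

End Primitive.
End Cadlag.

(** * Collapse of the ensemble along a fixed path *)

Section DeriveReal.
Variables (R : realType).


Lemma is_derive_addf (V : normedModType R) (f g : R -> V) (t : R) df dg :
  is_derive t 1 f df -> is_derive t 1 g dg ->
  is_derive t 1 (fun s => f s + g s) (df + dg).
Proof. exact: is_deriveD. Qed.

Lemma is_derive_subf (V : normedModType R) (f g : R -> V) (t : R) df dg :
  is_derive t 1 f df -> is_derive t 1 g dg ->
  is_derive t 1 (fun s => f s - g s) (df - dg).
Proof. exact: is_deriveB. Qed.

Lemma is_derive_mulf (f g : R -> R) (t df dg : R) :
  is_derive t 1 f df -> is_derive t 1 g dg ->
  is_derive t 1 (fun s => f s * g s) (f t * dg + g t * df).
Proof. exact: is_deriveM. Qed.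

Lemma is_derive_scalef (V : normedModType R) (f : R -> V) (k t : R) df :
  is_derive t 1 f df -> is_derive t 1 (fun s => k *: f s) (k *: df).
Proof. exact: is_deriveZ. Qed.

Lemma is_derive_sumf (V : normedModType R) m (F : 'I_m -> R -> V) (t : R) (dF : 'I_m -> V) :
  (forall l, is_derive t 1 (F l) (dF l)) ->
  is_derive t 1 (fun s => \sum_l F l s) (\sum_l dF l).
Proof.
move=> H; rewrite (_ : (fun _ => _) = \sum_l F l); first exact: is_derive_sum.
by apply/funext => s; rewrite fct_sumE.
Qed.

Lemma is_derive_sqrf (f : R -> R) (t df : R) :
  is_derive t 1 f df -> is_derive t 1 (fun s => f s ^+ 2) (2 * f t * df).
Proof.
move=> fdf; rewrite (_ : (fun _ => _) = fun s => f s * f s); last first.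
  by apply/funext => s; rewrite expr2.
by apply: (is_derive_eq (is_derive_mulf fdf fdf)); ring.
Qed.

Lemma is_derive_expRM (k t : R) :
  is_derive t 1 (fun s => expR (k * s)) (expR (k * t) * k).
Proof.
have dk : is_derive t 1 (fun s : R => k * s) k.
  have := is_derive_mulf (is_derive_cst k t 1) (is_derive_id t 1).
  by rewrite /= mulr0 addr0 mulr1.
exact: (@is_derive1_comp R expR (fun s => k * s) t _ _ (is_derive_expR _) dk).
Qed.

Lemma continuous_expRM (k : R) : continuous (fun s => expR (k * s)).
Proof.
move=> s; apply: (@cvg_comp _ _ _ (fun s => k * s) expR); last exact: continuous_expR.
by apply: cvgM; [exact: cvg_cst|exact: cvg_id].
Qed.

End DeriveReal.

Definition deviation (R : realType) n N (x : R -> 'I_N -> 'cV[R]_n) s l :=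
  x s l - ens_mean (x s).

Section EnsembleAlgebra.
Variables (R : realType) (n N : nat) (x : 'I_N -> 'cV[R]_n).
Let e l := x l - ens_mean x.
Let c1 : R := (N.-1)%:R^-1.

Lemma ens_cov_mulmx u : ens_cov x *m u = c1 *: \sum_l dotp (e l) u *: e l.
Proof.
rewrite /ens_cov -scalemxAl mulmx_suml; congr (_ *: _); apply: eq_bigr => l _.
rewrite -/(e l) -mulmxA [X in _ *m X]mx11_scalar mul_mx_scalar; congr (_ *: _).
Qed.

Lemma dotp_ens_cov u w :
  dotp w (ens_cov x *m u) = c1 * \sum_l dotp u (e l) * dotp w (e l).
Proof.
rewrite ens_cov_mulmx dotpZr dotp_sumr; congr (_ * _); apply: eq_bigr => l _.
by rewrite dotpZr dotpC.
Qed.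

Lemma ens_cov_tr : (ens_cov x)^T = ens_cov x.
Proof.
rewrite /ens_cov linearZ /= linear_sum /=; congr (_ *: _); apply: eq_bigr => l _.
by rewrite trmx_mul trmxK.
Qed.

Lemma norm_ens_cov_le D : (forall l, `|e l| <= D) -> `|ens_cov x| <= c1 * (N%:R * D ^+ 2).
Proof.
move=> eD; rewrite /ens_cov normrZ ger0_norm ?invr_ge0//.
rewrite ler_wpM2l ?invr_ge0// (le_trans (ler_norm_sum _ _ _))//.
rewrite -[N in N%:R]card_ord mulr_natl -sumr_const ler_sum// => l _.
apply: le_trans (ler_norm_mulmx _ _) _.
by rewrite mul1r norm_tr -/(e l) expr2 ler_pM// eD.
Qed.

End EnsembleAlgebra.

Section Flow.
Variables (R : realType) (n N Nsub : nat).
Hypothesis N1 : (1 < N)%N.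
Variables (H : 'I_Nsub -> 'M[R]_n) (b : 'I_Nsub -> 'cV[R]_n).
Variable lam : R.
Hypotheses (lam0 : 0 < lam) (Hsym : forall a, (H a)^T = H a).
Hypothesis Hlam : forall a v, lam * `|v| ^+ 2 <= dotp v (H a *m v).
Variable x0 : 'I_N -> 'cV[R]_n.

Local Notation c1 := ((N.-1)%:R^-1 : R).

(** One realisation of the particle system, driven by the path i. *)
Definition flow (i : R -> 'I_Nsub) (x : R -> 'I_N -> 'cV[R]_n) :=
  [/\ cadlag_path i, x 0 = x0, forall j, continuous (x ^~ j) &
      forall t, 0 < t -> regular i t -> forall j,
      is_derive t 1 (x ^~ j)
        (- (ens_cov (x t) *m (H (i t) *m x t j - b (i t))))].

Let N0 : N%:R != 0 :> R.
Proof. by rewrite pnatr_eq0 -lt0n ltnW. Qed.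

Let c10 : 0 < c1.
Proof. by rewrite invr_gt0 ltr0n -ltnS prednK// ltnW. Qed.

Section OneFlow.
Variables (i : R -> 'I_Nsub) (x : R -> 'I_N -> 'cV[R]_n).
Hypothesis ix : flow i x.
Local Notation e := (deviation x).
Local Notation C t := (ens_cov (x t)).

Lemma continuous_deviation l : continuous (fun s => e s l).
Proof.
case: ix => _ _ cx _ s; apply: cvgB; first exact: cx.
apply: cvgZ; first exact: cvg_cst.
move: s.
by apply: continuous_sum => k _; exact: cx.
Qed.

Lemma is_derive_deviation t l : 0 < t -> regular i t ->
  is_derive t 1 (fun s => e s l) (- (C t *m (H (i t) *m e t l))).
Proof.
case: ix => _ _ _ dx t0 rt.
apply: is_derive_eq.
  apply: is_derive_subf; first exact: dx.
  by apply: is_derive_scalef; apply: is_derive_sumf => k; exact: dx.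
have meanE : N%:R^-1 *: \sum_k (C t *m (H (i t) *m x t k - b (i t))) =
    C t *m (H (i t) *m ens_mean (x t) - b (i t)).
  rewrite -mulmx_sumr scalemxAr; congr (_ *m _).
  rewrite sumrB -mulmx_sumr sumr_const card_ord scalerBr -[b _ *+ _]scaler_nat.
  by rewrite scalerA mulVf// scale1r scalemxAr.
rewrite sumrN scalerN opprK meanE /deviation [in RHS]mulmxBr mulmxBr.
by rewrite !mulmxBr opprB addrC addrA subrK opprB.
Qed.

(** The variance of the ensemble in the direction u, see dir_varE. *)
Definition dir_var u s := c1 * \sum_l dotp u (e s l) ^+ 2.

Lemma dir_varE u s : dir_var u s = dotp u (C s *m u).
Proof. by rewrite dotp_ens_cov; congr (_ * _); apply: eq_bigr => l _; rewrite expr2. Qed.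

Lemma dir_var_ge0 u s : 0 <= dir_var u s.
Proof. by rewrite mulr_ge0 ?(ltW c10)// sumr_ge0// => l _; rewrite sqr_ge0. Qed.

Lemma continuous_dir_var u : continuous (dir_var u).
Proof.
move=> s; apply: cvgM; first exact: cvg_cst.
move: s; apply: continuous_sum => l _ s.
have cd := @continuous_dotp _ _ _ u _ (@continuous_deviation l) s.
by apply: (cvgM (f := fun s => dotp u (e s l)) (g := fun s => dotp u (e s l))); exact: cd.
Qed.

Lemma is_derive_dir_var u t : 0 < t -> regular i t ->
  is_derive t 1 (dir_var u) (- (2 * dotp (C t *m u) (H (i t) *m (C t *m u)))).
Proof.
move=> t0 rt; apply: is_derive_eq.
  apply: (is_derive_scalef (V := R)); apply: is_derive_sumf => l.
  by apply: is_derive_sqrf; apply: is_derive_dotp; exact: is_derive_deviation.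
rewrite dotp_mulmxr Hsym dotp_ens_cov mulrCA -mulrN; congr (_ * _).
rewrite mulr_sumr -sumrN; apply: eq_bigr => l _.
rewrite dotpNr dotp_mulmxr ens_cov_tr dotp_mulmxr Hsym; ring.
Qed.

Lemma dotp_H_ge0 a v : 0 <= dotp v (H a *m v).
Proof. by apply: le_trans (Hlam _ _); rewrite mulr_ge0 ?(ltW lam0)// sqr_ge0. Qed.

Lemma dir_var_nonincreasing u s t : 0 <= s -> s <= t -> dir_var u t <= dir_var u s.
Proof.
move=> s0 st; have [cad _ _ _] := ix.
apply: (piecewise_nonincreasing (cadlag_piecewise cad)
  (df := fun t => - (2 * dotp (C t *m u) (H (i t) *m (C t *m u))))) => //.
- exact: continuous_dir_var.
- by move=> r /andP[sr _] rr; apply: is_derive_dir_var => //; exact: le_lt_trans sr.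
- by move=> r _ _; rewrite oppr_le0 mulr_ge0// dotp_H_ge0.
Qed.

Lemma dotp_deviation_sqr u s l : dotp u (e s l) ^+ 2 <= (N.-1)%:R * dir_var u s.
Proof.
rewrite /dir_var mulrA divff ?mul1r; last by rewrite -invr_eq0 gt_eqF.
by rewrite (bigD1 l)//= lerDl sumr_ge0// => k _; rewrite sqr_ge0.
Qed.

(** The variance in the direction u starts at 0, is nonincreasing and nonnegative. *)
Lemma deviation_orthogonal u : (forall l, dotp u (e 0 l) = 0) ->
  forall t l, 0 <= t -> dotp u (e t l) = 0.
Proof.
move=> u0 t l t0; apply/eqP; rewrite -sqrf_eq0 eq_le sqr_ge0 andbT.
apply: le_trans (dotp_deviation_sqr _ _ _) _.
have : dir_var u t <= dir_var u 0 by exact: dir_var_nonincreasing.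
have -> : dir_var u 0 = 0.
  by rewrite /dir_var big1 ?mulr0// => k _; rewrite u0 expr0n.
by move=> k0; rewrite mulr_ge0_le0.
Qed.

(** Riccati: for a unit vector the variance v satisfies v' <= - 2 lam v^2, so
1/v - 2 lam t is nondecreasing. *)
Lemma dir_var_coord_decay p t B : 0 <= t ->
  dir_var (delta_mx p 0) 0 <= B -> (2 * lam)^-1 <= B ->
  dir_var (delta_mx p 0) t <= B / (1 + t).
Proof.
set u := delta_mx p 0 => t0 B1 B2.
have B0 : 0 < B by apply: lt_le_trans B2; rewrite invr_gt0 mulr_gt0.
have t1 : 0 < 1 + t by lra.
set K := dir_var u t.
have [K0|Kpos] := leP K 0; first by apply: le_trans K0 _; rewrite divr_ge0// ltW.
have [cad _ _ _] := ix.
(* The maximum keeps the reciprocal continuous on the whole line, and changes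
   nothing on [0, t], where the variance is at least K. *)
pose m s := Num.max (dir_var u s) K.
have m0 s : 0 < m s by rewrite lt_max Kpos orbT.
have cm : continuous m.
  have : continuous (dir_var u \max cst K : R -> R^o).
    by move=> s; apply: continuous_max; [exact: continuous_dir_var|exact: cvg_cst].
  exact.
have mE s : 0 <= s <= t -> m s = dir_var u s.
  by move=> /andP[s0 st]; apply/max_idPl; exact: dir_var_nonincreasing.
pose dk s := - (2 * dotp (C s *m u) (H (i s) *m (C s *m u))).
have dm s : 0 < s < t -> regular i s -> is_derive s 1 m (dk s).
  move=> /andP[s0 st] rs; apply: (@is_derive_near _ _ (dir_var u)); last exact: is_derive_dir_var.
  near=> r; rewrite mE//; apply/andP; split; apply/ltW.
    by near: r; exact: lt_nbhsr.
  by near: r; exact: lt_nbhsl.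
have H1 : - (m t)^-1 + 2 * lam * t <= - (m 0)^-1 + 2 * lam * 0.
  apply: (piecewise_nonincreasing (cadlag_piecewise cad) (a := 0) (b := t)
    (f := fun s => - (m s)^-1 + 2 * lam * s)
    (df := fun s => - (- (m s) ^- 2 *: dk s) + 2 * lam * 1)) => //.
  - move=> s; apply: cvgD.
      by apply: cvgN; apply: cvgV; [rewrite gt_eqF|exact: cm].
    by apply: cvgM; [exact: cvg_cst|exact: cvg_id].
  - move=> s s0t rs; apply: is_derive_addf.
      by apply: is_deriveN; apply: is_deriveV; [rewrite gt_eqF|exact: dm].
  - move=> s /andP[s0 st] rs; rewrite mE ?(ltW s0) ?(ltW st)// /dk.
    rewrite scaleNr opprK /GRing.scale /= mulrN mulr1 addrC subr_le0.
    have ks : 0 < dir_var u s by apply: lt_le_trans Kpos _; apply: dir_var_nonincreasing; exact: ltW.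
    rewrite ler_pdivlMl ?exprn_gt0//.
    have := Hlam (i s) (C s *m u); set d := dotp _ _ => Hd.
    have : dir_var u s ^+ 2 <= `|C s *m u| ^+ 2.
      rewrite ler_pXn2r ?nnegrE ?dir_var_ge0//.
      by rewrite dir_varE dotp_delta (le_trans (ler_norm _))// ler_entry.
    by move=> ka; have := ler_wpM2l (ltW lam0) ka; move: Hd; lra.
rewrite !mE ?lexx ?t0// in H1.
have k0 : 0 < dir_var u 0 by apply: lt_le_trans Kpos _; exact: dir_var_nonincreasing.
have H2 : B^-1 <= (dir_var u 0)^-1 by rewrite lef_pV2 ?posrE.
have H3 : B^-1 <= 2 * lam.
  by rewrite -[leRHS]invrK lef_pV2 ?posrE ?invr_gt0 ?mulr_gt0.
have H4 : B^-1 * (1 + t) <= K^-1.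
  move: H1; rewrite -/K; nra.
rewrite -[leLHS]invrK -[leRHS]invrK lef_pV2 ?posrE ?invr_gt0 ?divr_gt0//.
by rewrite invf_div mulrC.
Unshelve. all: by end_near. Qed.

End OneFlow.

(** The rate at which the deviations vanish. *)
Definition decay (t : R) : R := (Num.sqrt (1 + t))^-1.

Lemma decay_gt0 t : 0 <= t -> 0 < decay t.
Proof. by move=> t0; rewrite invr_gt0 sqrtr_gt0; lra. Qed.

Lemma decay_le1 t : 0 <= t -> decay t <= 1.
Proof.
move=> t0; rewrite invf_le1 ?sqrtr_gt0; last by lra.
by rewrite -[leLHS]sqrtr1 ler_wsqrtr//; lra.
Qed.

Lemma decay_sqr t : 0 <= t -> decay t ^+ 2 = (1 + t)^-1.
Proof. by move=> t0; rewrite exprVn sqr_sqrtr//; lra. Qed.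

Lemma deviation_decay : exists2 B, 0 <= B &
  forall i x, flow i x -> forall t l, 0 <= t ->
    `|deviation x t l| <= B * decay t.
Proof.
pose k0 (p : 'I_n) : R := c1 * \sum_l dotp (delta_mx p 0) (x0 l - ens_mean x0) ^+ 2.
have k00 p : 0 <= k0 p.
  by rewrite mulr_ge0 ?(ltW c10)// sumr_ge0// => l _; rewrite sqr_ge0.
pose beta := \sum_p k0 p + (2 * lam)^-1.
have l0 : 0 < (2 * lam)^-1 by rewrite invr_gt0 mulr_gt0.
have beta0 : 0 <= beta by apply: addr_ge0; [exact: sumr_ge0|exact: ltW].
have N10 : 0 <= (N.-1)%:R * beta by rewrite mulr_ge0.
exists (Num.sqrt ((N.-1)%:R * beta)); first exact: sqrtr_ge0.
move=> i x ix t l t0; have d0 := decay_gt0 t0.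
apply: mx_norm_le => [|p q]; first by rewrite mulr_ge0 ?sqrtr_ge0 ?(ltW d0).
rewrite ord1 -[leLHS]ger0_norm// -ler_sqr ?nnegrE ?mulr_ge0 ?sqrtr_ge0 ?(ltW d0)//.
rewrite ger0_norm// real_normK ?num_real// exprMn sqr_sqrtr// decay_sqr//.
rewrite -dotp_delta; apply: le_trans (dotp_deviation_sqr _ _ _ _) _.
rewrite -mulrA ler_wpM2l//; apply: (dir_var_coord_decay ix) => //.
  have [_ x0_ _ _] := ix; rewrite /dir_var /deviation x0_.
  rewrite -/(k0 p) /beta (bigD1 p)//= -addrA lerDl addr_ge0 ?(ltW l0)//.
  by rewrite sumr_ge0.
by rewrite /beta lerDr sumr_ge0.
Qed.

Let H_norm_bound : exists2 h, 0 <= h & forall a, `|H a| <= h.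
Proof.
exists (\sum_a `|H a|) => [|a]; first by rewrite sumr_ge0.
by rewrite (bigD1 a)//= lerDl sumr_ge0.
Qed.

Lemma velocity_decay : exists2 B, 0 <= B &
  forall i x, flow i x -> forall t l, 0 <= t ->
    `|ens_cov (x t) *m (H (i t) *m deviation x t l)| <= B * decay t ^+ 3.
Proof.
have [D D0 HD] := deviation_decay; have [h h0 Hh] := H_norm_bound.
exists (n%:R * (c1 * (N%:R * D ^+ 2) * (n%:R * (h * D)))).
  by rewrite ?(mulr_ge0, ler0n, ltW c10, exprn_ge0).
move=> i x ix t l t0; have d0 := ltW (decay_gt0 t0).
apply: le_trans (ler_norm_mulmx _ _) _.
rewrite -[leRHS]mulrA ler_wpM2l//.
have C1 := norm_ens_cov_le (fun k => HD i x ix t k t0).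
have H1 : `|H (i t) *m deviation x t l| <= n%:R * (h * (D * decay t)).
  apply: le_trans (ler_norm_mulmx _ _) _.
  by rewrite ler_wpM2l// ler_pM// (HD _ _ ix).
apply: le_trans (ler_pM _ _ C1 H1) _ => //.
by rewrite le_eqVlt; apply/orP; left; apply/eqP; ring.
Qed.

Section Representation.
Variables (ts : 'cV[R]_n) (j : 'I_N).
Let gam a := H a *m ts - b a.
(** The drift of the l-th coordinate of the error while the index is a. *)
Definition noise (x : R -> 'I_N -> 'cV[R]_n) l a s := c1 * dotp (gam a) (deviation x s l).

(** Variation of constants. With c_l obtained by integrating its drift, the remainder
r of the representation satisfies r' = - C H_i r and r(0) = 0, so it vanishes by
Gronwall's argument. *)
Lemma ensemble_coordinates c0 i x : flow i x ->
  x0 j - ts = \sum_l c0 l *: (x0 l - ens_mean x0) ->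
  exists c : R -> 'I_N -> R,
  [/\ forall l, c 0 l = c0 l, forall l, continuous (c ^~ l),
      forall t, 0 < t -> regular i t -> forall l,
        is_derive t 1 (c ^~ l) (- noise x l (i t) t) &
      forall t, 0 <= t -> x t j - ts = \sum_l c t l *: deviation x t l].
Proof.
move=> ix x0E; have [cad x0' cx dx] := ix.
have cnoise l a : continuous (noise x l a).
  move=> s; apply: cvgM; first exact: cvg_cst.
  have cd := @continuous_dotp _ _ _ (gam a) _ (@continuous_deviation _ _ ix l) s.
  exact: cd.
have [F Fp] := choice (fun l => cadlag_primitive cad (cnoise l)).
pose c t l := c0 l - F l t.
have c_0 l : c 0 l = c0 l by rewrite /c; have [_ -> _] := Fp l; rewrite subr0.
have cc l : continuous (c ^~ l).
  by move=> s; apply: cvgB; [exact: cvg_cst|have [+ _ _] := Fp l; exact].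
have dc t : 0 < t -> regular i t -> forall l,
    is_derive t 1 (c ^~ l) (- noise x l (i t) t).
  move=> t0 rt l; have [_ _ dF] := Fp l; rewrite -sub0r.
  by apply: is_derive_subf; exact: dF.
exists c; split => // t t0.
pose r s := x s j - ts - \sum_l c s l *: deviation x s l.
suff r0 : dotp (r t) (r t) = 0.
  apply/eqP; rewrite -subr_eq0 -/(r t) -normr_eq0 -sqrf_eq0 eq_le sqr_ge0 andbT.
  by rewrite -r0 sqr_norm_le_dotp.
have rE s p : r s p 0 = x s j p 0 - ts p 0 - \sum_l c s l * deviation x s l p 0.
  by rewrite /r !mxE summxE; congr (_ - _); apply: eq_bigr => l _; rewrite mxE.
have cdev l p : continuous (fun s => deviation x s l p 0).
  have := @continuous_coord R 1 _ n _ p 0 (@continuous_deviation _ _ ix l).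
  by [].
have cr p : continuous (fun s => r s p 0).
  rewrite (_ : (fun _ => _) = fun s => x s j p 0 - ts p 0 - \sum_l c s l * deviation x s l p 0).
    move=> s; apply: cvgB; first apply: cvgB.
    - have cxp := @continuous_coord R 1 _ n _ p 0 (cx j) s.
      exact: cxp.
    - exact: cvg_cst.
    - move: s; apply: continuous_sum => l _ s; apply: cvgM; [exact: cc|exact: cdev].
  by apply/funext => s; rewrite rE.
have dr s p : 0 < s -> regular i s ->
    is_derive s 1 (fun s => r s p 0)
      ((- (ens_cov (x s) *m (H (i s) *m r s))) p 0).
  move=> s0 rs.
  rewrite (_ : (fun _ => _) = fun s => x s j p 0 - ts p 0 - \sum_l c s l * deviation x s l p 0);
    last by apply/funext => ?; rewrite rE.
  apply: is_derive_eq.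
    apply: is_derive_subf.
      apply: is_derive_subf.
      exact: (is_derive_coord p 0 (dx s s0 rs j)).
    apply: is_derive_sumf => l; apply: is_derive_mulf; first exact: dc.
    exact: (is_derive_coord p 0 (is_derive_deviation ix l s0 rs)).
  set Ct := ens_cov (x s); set Ht := H (i s).
  have sumE : \sum_l (c s l * (- (Ct *m (Ht *m deviation x s l))) p 0 +
      deviation x s l p 0 * - noise x l (i s) s) =
      (- (Ct *m (Ht *m \sum_l c s l *: deviation x s l)) - Ct *m gam (i s)) p 0.
    rewrite big_split /= [in RHS]mxE; congr (_ + _).
      rewrite !mulmx_sumr mxE summxE -sumrN; apply: eq_bigr => l _.
      by rewrite -!scalemxAr !mxE mulrN.
    rewrite mxE ens_cov_mulmx mxE summxE mulr_sumr -sumrN; apply: eq_bigr => l _.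
    have mxZp a (v : 'cV[R]_n) : (a *: v) p 0 = a * v p 0 by rewrite mxE.
    by rewrite /noise mxZp -/(deviation x s l) [dotp _ (gam _)]dotpC; ring.
  rewrite sumE subr0 /r /gam -/Ht.
  set z := \sum_l _.
  have -> : - (Ct *m (Ht *m (x s j - ts - z))) =
    - (Ct *m (Ht *m x s j - b (i s))) - (- (Ct *m (Ht *m z)) - Ct *m (Ht *m ts - b (i s))).
    rewrite !mulmxBr; move: (Ct *m (Ht *m x s j)) (Ct *m (Ht *m ts))
      (Ct *m (Ht *m z)) (Ct *m b (i s)) => u v w u'.
    by apply/colP => q; rewrite !mxE; ring.
  have mxBp (u v : 'cV[R]_n) : (u - v) p 0 = u p 0 - v p 0 by rewrite !mxE.
  by rewrite [RHS]mxBp.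
have [D D0 HD] := deviation_decay; have [h h0 Hh] := H_norm_bound.
(* A crude bound for the growth rate of the square of r. *)
pose K := 2 * (n%:R * (n%:R * (c1 * (N%:R * D ^+ 2) * (n%:R * h)))).
pose dk s := 2 * dotp (r s) (- (ens_cov (x s) *m (H (i s) *m r s))).
have dkK s : 0 <= s -> dk s <= K * dotp (r s) (r s).
  move=> s0; have d1 := decay_le1 s0; have d0 := ltW (decay_gt0 s0).
  rewrite /dk /K -!mulrA ler_wpM2l//.
  apply: le_trans (ler_norm _) _; apply: le_trans (ler_dotp _ _) _.
  rewrite ler_wpM2l// normrN.
  have C1 : `|ens_cov (x s)| <= c1 * (N%:R * D ^+ 2).
    apply: norm_ens_cov_le => l; apply: le_trans (HD _ _ ix _ _ s0) _.
    by rewrite ler_piMr.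
  have H1 : `|H (i s) *m r s| <= n%:R * (h * `|r s|).
    apply: le_trans (ler_norm_mulmx _ _) _.
    by rewrite ler_wpM2l// ler_wpM2r.
  have CH : `|ens_cov (x s) *m (H (i s) *m r s)| <=
     n%:R * (c1 * (N%:R * D ^+ 2) * (n%:R * (h * `|r s|))).
    apply: le_trans (ler_norm_mulmx _ _) _.
    by rewrite ler_wpM2l// ler_pM.
  apply: le_trans (ler_wpM2l _ CH) _ => //.
  have := sqr_norm_le_dotp (r s); set d := dotp _ _; set a := `|r s| => ad.
  rewrite (_ : a * _ = n%:R * (c1 * (N%:R * D ^+ 2) * (n%:R * h)) * a ^+ 2); last by ring.
  rewrite -!mulrA [leRHS](_ : _ = n%:R * (c1 * (N%:R * D ^+ 2) * (n%:R * h)) * d); last by ring.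
  rewrite [leLHS](_ : _ = n%:R * (c1 * (N%:R * D ^+ 2) * (n%:R * h)) * a ^+ 2); last by ring.
  by rewrite ler_wpM2l// !mulr_ge0 ?(ltW c10) ?exprn_ge0.
pose g s := expR (- K * s) * dotp (r s) (r s).
have rsq s : dotp (r s) (r s) = \sum_p r s p 0 ^+ 2 by rewrite dotp_self.
have H1 : g t <= g 0.
  apply: (@piecewise_nonincreasing _ _ (cadlag_piecewise cad) g
    (fun s => expR (- K * s) * dk s +
        dotp (r s) (r s) * (expR (- K * s) * - K)) 0 t).
  - exact: lexx.
  - exact: t0.
  - move=> s; apply: cvgM.
      exact: continuous_expRM.
    rewrite (_ : (fun s => dotp (r s) (r s)) = fun s => \sum_p r s p 0 ^+ 2);
      last exact/funext.
    rewrite rsq; move: s; apply: continuous_sum => p _ s.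
    by apply: (cvgM (f := fun s => r s p 0) (g := fun s => r s p 0)); exact: cr.
  - move=> s /andP[s0 _] rs; apply: is_derive_mulf.
      exact: is_derive_expRM.
    rewrite (_ : (fun s => dotp (r s) (r s)) = fun s => \sum_p r s p 0 ^+ 2);
      last exact/funext.
    apply: is_derive_eq.
      by apply: is_derive_sumf => p; apply: is_derive_sqrf; exact: dr.
    rewrite /dk dotpE mulr_sumr; apply: eq_bigr => p _.
    by rewrite mulrA.
  - move=> s /andP[s0 _] rs; have := dkK s (ltW s0).
    have := expR_ge0 (- K * s); set E := expR _; set d := dotp _ _ => E0 dkd.
    rewrite (_ : _ + _ = E * (dk s - K * d)); last by ring.
    by rewrite mulr_ge0_le0// subr_le0.
apply/eqP; rewrite eq_le dotp_self_ge0 andbT.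
rewrite -(pmulr_rle0 _ (expR_gt0 (- K * t))) -/(g t) (le_trans H1)// /g.
have -> : r 0 = 0.
  by rewrite /r x0' x0E; apply/eqP; rewrite subr_eq0; apply/eqP/eq_bigr => l _; rewrite c_0 /deviation x0'.
by rewrite dotp0r mulr0.
Qed.

End Representation.

End Flow.

(** * Grid estimate for integrals along a path *)

Lemma summation_by_parts (R : comNzRingType) (p S : nat -> R) m :
  \sum_(0 <= k < m) p k * (S k.+1 - S k) =
  p m * S m - p 0%N * S 0%N - \sum_(0 <= k < m) (p k.+1 - p k) * S k.+1.
Proof.
elim: m => [|m IH]; first by rewrite !big_geq// subrr subr0.
rewrite !big_nat_recr//= IH.
set a := \sum_(_ <= _ < _) _; ring.
Qed.

Section PathEstimate.
Variables (R : realType) (n : nat) (i : R -> 'I_n).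
Hypothesis cad : cadlag_path i.

(** A cell is bad when the path is not constant on it. Gluing two intervals adds at
most the cell that contains the common endpoint, so the number of bad cells is
bounded uniformly in the mesh. *)
Lemma cadlag_bad_cells t : 0 < t -> exists C : nat, forall h, 0 < h ->
  exists s : seq nat, (size s <= C)%N /\ forall k, k \notin s ->
    k.+1%:R * h <= t -> forall r, k%:R * h <= r < k.+1%:R * h -> i r = i (k%:R * h).
Proof.
move=> t0.
pose Q u v := exists C : nat, forall h, 0 < h ->
  exists s : seq nat, (size s <= C)%N /\ forall k, k \notin s ->
    u <= k%:R * h -> k.+1%:R * h <= v ->
    forall r, k%:R * h <= r < k.+1%:R * h -> i r = i (k%:R * h).
suff [C HC] : Q 0 t.
  exists C => h h0; have [s [sC Hs]] := HC h h0; exists s; split => // k ks kt.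
  by apply: Hs => //; rewrite mulr_ge0// ltW.
apply: (cadlag_interval_induction cad) => //.
- move=> u v w u0 uv vw _ [C1 H1] [C2 H2]; exists (C1 + C2 + 1)%N => h h0.
  have [s1 [sC1 Hs1]] := H1 h h0; have [s2 [sC2 Hs2]] := H2 h h0.
  pose k0 := Num.trunc (v / h).
  exists (s1 ++ s2 ++ [:: k0]); split.
    by rewrite !size_cat /= addnA; rewrite leq_add2r leq_add.
  move=> k; rewrite !mem_cat inE !negb_or => /and3P[k1 k2 kk0] uk kw.
  have [kv|vk] := leP (k.+1%:R * h) v; first exact: Hs1.
  apply: Hs2 => //; rewrite leNgt; apply/negP => kv.
  move: kk0 => /negP; apply; apply/eqP.
  have v0 : 0 <= v / h by rewrite divr_ge0 ?(ltW h0)// (le_trans u0)// ltW.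
  have /andP[l1 l2] := truncn_itv v0.
  have kvh : k%:R <= v / h by rewrite ler_pdivlMr// ltW.
  have vkh : v / h < k.+1%:R by rewrite ltr_pdivrMr.
  have k1' : (k < k0.+1)%N by rewrite -(ltr_nat R) (le_lt_trans kvh l2).
  have k2' : (k0 < k.+1)%N by rewrite -(ltr_nat R) (le_lt_trans l1 vkh).
  by apply/eqP; rewrite eqn_leq; apply/andP.
- move=> u v c u0 uv vt uvc; exists 0%N => h h0; exists [::]; split => // k _ uk kv r /andP[kr rk].
  have hk : k%:R * h < k.+1%:R * h by rewrite ltr_pM2r// ltr_nat.
  rewrite !uvc//; first by rewrite uk (lt_le_trans hk).
  by rewrite (le_trans uk kr) (lt_le_trans rk kv).
Qed.

Definition centred h a l : R := (i (l%:R * h) == a)%:R - n%:R^-1.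
(** Riemann sum for the centred occupation time of state a up to time k h. *)
Definition csum h a k : R := h * \sum_(0 <= l < k) centred h a l.

(** What summation by parts leaves of the integral of a function bounded by decay,
with derivative bounded by decay^3, against the centred occupation of a. *)
Definition noise_weight h a m : R :=
  decay (m%:R * h) * `|csum h a m| +
  \sum_(0 <= k < m) h * decay (k%:R * h) ^+ 3 * `|csum h a k.+1|.

(** F t - F 0 is the sum of its increments over the cells. On a good cell the
increment is - h psi_(i) up to O(h^2), on a bad one it is O(h). Since the psi_a
add up to 0, the indicator of i = a may be centred before summing by parts. *)
Lemma path_estimate (F : R -> R) (psi dpsi : 'I_n -> R -> R) (B t : R) :
  0 <= B -> 0 < t ->
  continuous F ->
  (forall s, 0 < s -> regular i s -> is_derive s 1 F (- psi (i s) s)) ->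
  (forall a, continuous (psi a)) ->
  (forall a s, 0 < s -> regular i s -> is_derive s 1 (psi a) (dpsi a s)) ->
  (forall a s, 0 <= s -> `|psi a s| <= B * decay s) ->
  (forall a s, 0 < s -> `|dpsi a s| <= B * decay s ^+ 3) ->
  (forall s, 0 <= s -> \sum_a psi a s = 0) ->
  exists K, forall m, (0 < m)%N ->
    `|F t| <= `|F 0| + B * (\sum_a noise_weight (t / m%:R) a m) + K / m%:R.
Proof.
move=> B0 t0 cF dF cpsi dpsiE psiB dpsiB psi0.
have reg := cadlag_piecewise cad.
have [C HC] := cadlag_bad_cells t0.
exists (B * t ^+ 2 + C%:R * (2 * B * t)) => m m0.
have mR : 0 < m%:R :> R by rewrite ltr0n.
pose h := t / m%:R.
have h0 : 0 < h by rewrite divr_gt0.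
have mh : m%:R * h = t by rewrite mulrC divfK// gt_eqF.
pose T k : R := k%:R * h.
have T0 k : 0 <= T k by rewrite mulr_ge0// ltW.
have TS k : T k.+1 - T k = h by rewrite /T -natr1 mulrDl mul1r addrAC subrr add0r.
have Tle k : T k <= T k.+1 by rewrite -subr_ge0 TS ltW.
have Tt k : (k < m)%N -> T k.+1 <= t by move=> km; rewrite -mh ler_pM2r// ler_nat.
have psiB1 a s : 0 <= s -> `|psi a s| <= B.
  by move=> s0; apply: le_trans (psiB a s s0) _; rewrite ler_piMr// decay_le1.
have incr k : (k < m)%N -> `|F (T k.+1) - F (T k)| <= B * h.
  move=> km; rewrite -(TS k).
  apply: (piecewise_lipschitz reg (df := fun s => - psi (i s) s)) => //.
    by move=> s /andP[ks _] rs; apply: dF => //; exact: le_lt_trans ks.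
  by move=> s /andP[ks _] rs; rewrite normrN psiB1// (le_trans (T0 k))// ltW.
pose err k := F (T k.+1) - F (T k) + h * psi (i (T k)) (T k).
have errB k : (k < m)%N -> `|err k| <= 2 * B * h.
  move=> km; apply: le_trans (ler_normD _ _) _.
  have := incr k km; rewrite normrM (gtr0_norm h0).
  by have := ler_wpM2l (ltW h0) (psiB1 (i (T k)) (T k) (T0 k)); lra.
have errG k : (k < m)%N -> (forall r, T k <= r < T k.+1 -> i r = i (T k)) ->
    `|err k| <= B * h ^+ 2.
  move=> km good; set a := i (T k).
  pose G s := F s + psi a (T k) * s.
  have -> : err k = G (T k.+1) - G (T k).
    rewrite /err /G -(TS k); ring.
  rewrite expr2 mulrA -{2}(TS k).
  apply: (piecewise_lipschitz reg (df := fun s => - psi (i s) s + psi a (T k) * 1)) => //.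
  - move=> s; apply: cvgD; first exact: cF.
    by apply: cvgM; [exact: cvg_cst|exact: cvg_id].
  - move=> s /andP[ks _] rs; apply: is_derive_addf.
      by apply: dF => //; exact: le_lt_trans ks.
  - move=> s /andP[ks sk] rs; rewrite mulr1 good ?(ltW ks)// -/a.
    rewrite addrC distrC.
    apply: (@le_trans _ _ (B * (s - T k))); last first.
      by rewrite ler_wpM2l//; have := TS k; lra.
    apply: (@piecewise_lipschitz _ _ reg (psi a) (dpsi a)) => //; first exact: ltW.
      by move=> r /andP[kr _] rr; apply: dpsiE => //; exact: le_lt_trans kr.
    move=> r /andP[kr _] rr; have r0 : 0 < r by exact: le_lt_trans kr.
    apply: le_trans (dpsiB a r r0) _.
    by rewrite ler_piMr// exprn_ile1// ?decay_le1 ?ltW ?decay_gt0// ltW.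
have [bad [badC Hbad]] := HC h h0.
have errsum : \sum_(0 <= k < m) `|err k| <= (B * t ^+ 2 + C%:R * (2 * B * t)) / m%:R.
  apply: (@le_trans _ _ (\sum_(0 <= k < m) (B * h ^+ 2 + (k \in bad)%:R * (2 * B * h)))).
    rewrite !big_mkord; apply: ler_sum => k _.
    have [kbad|kgood] := boolP (nat_of_ord k \in bad).
      by apply: le_trans (errB k (ltn_ord k)) _; rewrite mul1r lerDr mulr_ge0 ?sqr_ge0.
    rewrite mul0r addr0; apply: errG => // r kr.
    by apply: Hbad => //; exact: Tt.
  rewrite big_split /= sumr_const_nat subn0 -mulr_suml.
  have bad_le : \sum_(0 <= k < m) (k \in bad)%:R <= C%:R :> R.
    rewrite -natr_sum ler_nat (leq_trans _ badC)//.
    rewrite -big_mkcond sum1_count /index_iota subn0 -size_filter uniq_leq_size//.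
      by rewrite filter_uniq// iota_uniq.
    by move=> k; rewrite mem_filter => /andP[].
  rewrite -[B * h ^+ 2 *+ m]mulr_natl [leRHS]mulrDl; apply: lerD.
    by rewrite -mh -mulrA le_eqVlt; apply/orP; left; apply/eqP; field; rewrite gt_eqF.
  rewrite -/h [leRHS](_ : _ = C%:R * (2 * B * h)); last by rewrite /h; field; rewrite gt_eqF.
  by rewrite ler_wpM2r// !mulr_ge0// ltW.
have FE : F t - F 0 = \sum_(0 <= k < m) err k - \sum_(0 <= k < m) h * psi (i (T k)) (T k).
  rewrite -sumrB -[in LHS]mh -[F 0](_ : F (T 0%N) = F 0) -/(T m); last by rewrite /T mul0r.
  rewrite -(telescope_sumr (fun k => F (T k)))//.
  by apply: eq_bigr => k _; rewrite /err addrK.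
have psiE k : psi (i (T k)) (T k) = \sum_a psi a (T k) * centred h a k.
  under eq_bigr => a _ do rewrite /centred mulrBr -/(T k).
  rewrite sumrB -mulr_suml psi0// mul0r subr0 (bigD1 (i (T k)))//= eqxx mulr1.
  by rewrite big1 ?addr0// => a; rewrite eq_sym => /negPf ->; rewrite mulr0.
have sumE : \sum_(0 <= k < m) h * psi (i (T k)) (T k) =
    \sum_a (psi a (T m) * csum h a m -
      \sum_(0 <= k < m) (psi a (T k.+1) - psi a (T k)) * csum h a k.+1).
  under eq_bigr => k _ do rewrite psiE mulr_sumr.
  rewrite exchange_big /=; apply: eq_bigr => a _.
  have := summation_by_parts (fun k => psi a (T k)) (csum h a) m.
  have -> : csum h a 0 = 0 by rewrite /csum big_geq// mulr0.
  rewrite mulr0 subr0 => <-; apply: eq_bigr => k _.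
  by rewrite /csum big_nat_recr//= [h * (_ + _)]mulrDr addrAC subrr add0r; ring.
have psi_incr a k : `|psi a (T k.+1) - psi a (T k)| <= B * (h * decay (T k) ^+ 3).
  rewrite -(TS k) [(_ - _) * _]mulrC mulrA.
  apply: (piecewise_lipschitz reg (df := dpsi a)) => //.
    by move=> r /andP[kr _] rr; apply: dpsiE => //; exact: le_lt_trans kr.
  move=> r /andP[kr _] rr; have r0 : 0 < r by exact: le_lt_trans kr.
  apply: le_trans (dpsiB a r r0) _; rewrite ler_wpM2l//.
  rewrite lerXn2r ?nnegrE ?(ltW (decay_gt0 _)) ?(ltW r0)//.
  rewrite lef_pV2 ?posrE ?sqrtr_gt0 ?ltr_pwDl//; last exact: ltW.
  by rewrite ler_wsqrtr// lerD2l ltW.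
have err_le : `|\sum_(0 <= k < m) err k| <= (B * t ^+ 2 + C%:R * (2 * B * t)) / m%:R.
  exact: le_trans (ler_norm_sum _ _ _) errsum.
set X := B * \sum_a _.
suff sum_le : `|\sum_(0 <= k < m) h * psi (i (T k)) (T k)| <= X.
  have -> : F t = F 0 + (F t - F 0) by ring.
  apply: le_trans (ler_normD _ _) _; rewrite -addrA lerD2l FE.
  by apply: le_trans (ler_normB _ _) _; rewrite addrC; apply: lerD => //; exact: err_le.
rewrite sumE; apply: le_trans (ler_norm_sum _ _ _) _.
rewrite /X mulr_sumr; apply: ler_sum => a _.
apply: le_trans (ler_normB _ _) _; rewrite /noise_weight mulrDr; apply: lerD.
  by rewrite normrM mulrA ler_wpM2r// psiB.
apply: le_trans (ler_norm_sum _ _ _) _; rewrite mulr_sumr; apply: ler_sum => k _.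
by rewrite normrM mulrA ler_wpM2r// psi_incr.
Qed.

End PathEstimate.

(** * Exponential forgetting of the index process *)

Section Transition.
Variables (R : realType) (n : nat) (eta : R -> R) (p : R -> R -> 'M[R]_n).
Hypotheses (n1 : (1 < n)%N) (eta0 : forall t, 0 <= t -> 0 < eta t).
Hypothesis pP : transition_function (rate_matrix n eta) p.
Variable M : R.
Hypothesis etaM : forall t, 0 <= t -> eta t <= M.

Let n0 : 0 < n%:R :> R.
Proof. by rewrite ltr0n ltnW. Qed.

Let nm0 : 0 < (n.-1)%:R :> R.
Proof. by rewrite ltr0n -ltnS prednK// ltnW. Qed.

Let nE : n%:R = (n.-1)%:R + 1 :> R.
Proof. by rewrite natr1 prednK// ltnW. Qed.

Section FromTime.
Variable s : R.
Hypothesis s0 : 0 <= s.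

Let pt t := p s (Num.max s t).

Let continuous_pt a b : continuous (fun t => pt t a b).
Proof.
apply: continuous_coord; have [_ cp _] := pP s0.
apply: (continuous_comp_within cp) => [|t].
  have : continuous (cst s \max id : R -> R^o).
    by move=> r; apply: continuous_max; [exact: cvg_cst|exact: cvg_id].
  exact.
by rewrite /= in_itv/= le_max lexx.
Qed.

Let ptE t : s <= t -> pt t = p s t.
Proof. by move=> st; rewrite /pt; congr (p s _); apply/max_idPr. Qed.

Let is_derive_pt a b t : s < t ->
  is_derive t 1 (fun t => pt t a b) ((pt t *m rate_matrix n eta t) a b).
Proof.
move=> st; apply: is_derive_coord; rewrite ptE ?(ltW st)//.
have [_ _ dp] := pP s0; apply: (@is_derive_near _ _ (p s)); last exact: dp.
near=> r; rewrite ptE//; apply: ltW; near: r; exact: lt_nbhsr.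
Unshelve. all: by end_near. Qed.

Lemma transition_row_sum a t : s <= t -> \sum_b p s t a b = 1.
Proof.
move=> st.
have regT : piecewise (setT : set R) by split => ? _; exact: filterE.
have eqn : `|(\sum_b pt t a b) - (\sum_b pt s a b)| <= 0 * (t - s).
  apply: (piecewise_lipschitz regT (f := fun t => \sum_b pt t a b)
    (df := fun t => \sum_b (pt t *m rate_matrix n eta t) a b)) => //.
  - by apply: continuous_sum => b _; exact: continuous_pt.
  - move=> r /andP[sr _] _; apply: is_derive_sumf => b; exact: is_derive_pt.
  - move=> r /andP[sr _] _.
    have er : eta r != 0 by rewrite gt_eqF// eta0// (le_trans s0)// ltW.
    under eq_bigr => b _ do rewrite mxE.
    rewrite exchange_big /= big1 ?normr0// => c _.
    rewrite -mulr_sumr (bigD1 c)//= mxE eqxx.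
    under eq_bigr => b bc do rewrite mxE eq_sym (negPf bc).
    rewrite sumr_const (_ : #|_| = n.-1); last by rewrite cardC1 card_ord.
    have -> : ((n.-1)%:R * eta r)^-1 *+ n.-1 = (eta r)^-1.
      by rewrite -[LHS]mulr_natl; field; rewrite er gt_eqF.
    by rewrite addNr mulr0.
move: eqn; rewrite mul0r normr_le0 subr_eq0 => /eqP; rewrite !ptE// => ->.
have [-> _ _] := pP s0; rewrite (bigD1 a)//= big1 ?addr0 ?mxE ?eqxx// => b ba.
by rewrite mxE eq_sym (negPf ba).
Qed.

(** The rows of p sum to 1, so the forward equation for D = p_ab - 1/n reads
D' = - n / ((n - 1) eta) D, and the rate is at least 1/M. *)
Lemma transition_decay a b t : s <= t ->
  `|p s t a b - n%:R^-1| <= expR (- (M^-1 * (t - s))).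
Proof.
move=> st.
have M0 : 0 < M by apply: lt_le_trans (etaM (lexx 0)); exact: eta0.
have regT : piecewise (setT : set R) by split => ? _; exact: filterE.
pose d t := pt t a b - n%:R^-1.
pose kap t := n%:R / ((n.-1)%:R * eta t).
have dd r : s < r -> is_derive r 1 d (- (kap r * d r)).
  move=> sr; have r0 : 0 <= r by apply: le_trans s0 _; exact: ltW.
  have er : eta r != 0 by rewrite gt_eqF// eta0.
  apply: is_derive_eq; first by apply: is_derive_subf; exact: is_derive_pt.
  rewrite subr0 mxE (bigD1 b)//= mxE eqxx.
  under eq_bigr => c bc do rewrite mxE (negPf bc).
  rewrite -mulr_suml.
  have -> : \sum_(c < n | c != b) pt r a c = 1 - pt r a b.
    have := transition_row_sum a (ltW sr); rewrite -ptE ?(ltW sr)// (bigD1 b)//= => <-.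
    by rewrite addrAC subrr add0r.
  rewrite /kap /d nE; field.
  by rewrite er -nE !gt_eqF.
pose E t := expR (2 * M^-1 * t).
pose g t := E t * d t ^+ 2.
have gle : g t <= g s.
  apply: (@piecewise_nonincreasing _ _ regT g
    (fun t => E t * (2 * d t * (- (kap t * d t))) + d t ^+ 2 * (E t * (2 * M^-1))) s t).
  - exact: s0.
  - exact: st.
  - move=> r; apply: cvgM; first exact: continuous_expRM.
    have cd : d r @[r --> r] --> d r.
      by apply: cvgB; [exact: continuous_pt|exact: cvg_cst].
    exact: (cvgM cd cd).
  - move=> r /andP[sr _] _; apply: is_derive_mulf; first exact: is_derive_expRM.
    by apply: is_derive_sqrf; exact: dd.
  - move=> r /andP[sr _] _.
    have r0 : 0 <= r by apply: le_trans s0 _; exact: ltW.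
    have kM : M^-1 <= kap r.
      apply: (@le_trans _ _ (eta r)^-1); first by rewrite lef_pV2 ?posrE ?etaM ?eta0.
      rewrite /kap invfM mulrA ler_peMl ?invr_ge0 ?(ltW (eta0 r0))//.
      by rewrite ler_pdivlMr// mul1r ler_nat leq_pred.
    rewrite [leLHS](_ : _ = E r * d r ^+ 2 * (2 * (M^-1 - kap r))); last by ring.
    apply: mulr_ge0_le0; first by rewrite mulr_ge0 ?sqr_ge0 ?expR_ge0.
    by apply: mulr_ge0_le0 => //; rewrite subr_le0.
have ds : d s ^+ 2 <= 1.
  rewrite /d ptE//; have [-> _ _] := pP s0; rewrite mxE.
  have i0 : 0 < n%:R^-1 :> R by rewrite invr_gt0.
  have i1 : n%:R^-1 <= 1 :> R by rewrite invf_le1// ler1n ltnW.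
  by case: eqP => _ /=; nra.
rewrite -[leRHS]ger0_norm ?expR_ge0// -ler_sqr ?nnegrE// !real_normK ?num_real//.
rewrite -ptE// -/(d t) -expRM_natl.
have Et : 0 < E t by exact: expR_gt0.
rewrite -(ler_pM2l Et) -/(g t); apply: le_trans gle _.
rewrite [leRHS](_ : _ = E s); last by rewrite /E -expRD; congr expR; ring.
by rewrite /g ler_piMr// expR_ge0.
Qed.

End FromTime.
End Transition.

(** * Moments of the centred occupation times *)

Section BoundedMean.
Variables (R : realType) (d : measure_display) (T : measurableType d).
Variable P : probability T R.
Implicit Types f g : T -> R.

Definition bounded_rv f := measurable_fun setT f /\ exists M, forall w, `|f w| <= M.

Definition mean f : R := \int[P]_w f w.

Lemma bounded_rv_integrable f : bounded_rv f -> P.-integrable setT (EFin \o f).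
Proof.
move=> [mf [M fM]]; apply: measurable_bounded_integrable => //.
  by rewrite [X in (X < _)%E](_ : _ = 1%E) ?ltry//; exact: probability_setT.
exists M; split; first exact: num_real.
by move=> x Mx w _; apply: le_trans (fM w) _; exact: ltW.
Qed.

Lemma bounded_rv_cst c : bounded_rv (fun=> c).
Proof. by split; [exact: measurable_cst|exists `|c|]. Qed.

Lemma bounded_rvD f g : bounded_rv f -> bounded_rv g -> bounded_rv (fun w => f w + g w).
Proof.
move=> [mf [M fM]] [mg [M' gM]]; split; first exact: measurable_funD.
by exists (M + M') => w; rewrite (le_trans (ler_normD _ _))// lerD.
Qed.

Lemma bounded_rvM f g : bounded_rv f -> bounded_rv g -> bounded_rv (fun w => f w * g w).
Proof.
move=> [mf [M fM]] [mg [M' gM]]; split; first exact: measurable_funM.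
by exists (M * M') => w; rewrite normrM ler_pM.
Qed.

Lemma bounded_rvZ c f : bounded_rv f -> bounded_rv (fun w => c * f w).
Proof. by move=> bf; apply: bounded_rvM => //; exact: bounded_rv_cst. Qed.

Lemma bounded_rv_norm f : bounded_rv f -> bounded_rv (fun w => `|f w|).
Proof.
move=> [mf [M fM]]; split; last by exists M => w; rewrite normr_id.
exact: measurableT_comp.
Qed.

Lemma bounded_rv_sum (I : Type) (r : seq I) (F : I -> T -> R) :
  (forall k, bounded_rv (F k)) -> bounded_rv (fun w => \sum_(k <- r) F k w).
Proof.
move=> bF; elim: r => [|k r IH].
  by under eq_fun do rewrite big_nil; exact: bounded_rv_cst.
by under eq_fun do rewrite big_cons; apply: bounded_rvD.
Qed.

Lemma bounded_rv_indic (A : set T) : measurable A -> bounded_rv (\1_A).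
Proof.
move=> mA; split; first exact: measurable_indic.
by exists 1 => w; rewrite indicE; case: (_ \in _); rewrite ?normr1 ?normr0.
Qed.

Lemma meanD f g : bounded_rv f -> bounded_rv g ->
  mean (fun w => f w + g w) = mean f + mean g.
Proof. by move=> bf bg; rewrite /mean RintegralD//; exact: bounded_rv_integrable. Qed.

Lemma meanZ c f : bounded_rv f -> mean (fun w => c * f w) = c * mean f.
Proof. by move=> bf; rewrite /mean RintegralZl//; exact: bounded_rv_integrable. Qed.

Lemma mean_cst c : mean (fun=> c) = c.
Proof.
rewrite /mean Rintegral_cst// (_ : fine _ = 1) ?mulr1//.
by rewrite [X in fine X](_ : _ = 1%E)//; exact: probability_setT.
Qed.

Lemma mean_sum (I : Type) (r : seq I) (F : I -> T -> R) :
  (forall k, bounded_rv (F k)) ->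
  mean (fun w => \sum_(k <- r) F k w) = \sum_(k <- r) mean (F k).
Proof.
move=> bF; elim: r => [|k r IH].
  by under eq_fun do rewrite big_nil; rewrite mean_cst big_nil.
under eq_fun do rewrite big_cons.
by rewrite meanD ?IH ?big_cons//; exact: bounded_rv_sum.
Qed.

Lemma mean_le f g : bounded_rv f -> bounded_rv g -> (forall w, f w <= g w) ->
  mean f <= mean g.
Proof. by move=> bf bg fg; apply: le_Rintegral => //; exact: bounded_rv_integrable. Qed.

Lemma mean_indic (A : set T) : measurable A -> mean (\1_A) = fine (P A).
Proof. by move=> mA; rewrite /mean /Rintegral integral_indic// setIT. Qed.

Lemma mean_EFin f : bounded_rv f -> (\int[P]_w (f w)%:E)%E = (mean f)%:E.
Proof.
move=> bf; rewrite /mean /Rintegral fineK//.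
by apply: integrable_fin_num => //; exact: bounded_rv_integrable.
Qed.

End BoundedMean.

Section Chain.
Variables (R : realType) (d : measure_display) (T : measurableType d).
Variables (P : probability T R) (n : nat) (eta : R -> R) (i : R -> T -> 'I_n).
Hypotheses (n1 : (1 < n)%N) (heta : learning_rate eta).
Hypothesis hi : index_process P eta i.

Let mi t a : 0 <= t -> measurable [set w | i t w = a].
Proof. by have [mi _ _ _] := hi; exact: mi. Qed.

Let state t a : T -> R := \1_[set w | i t w = a].

Let stateE t a w : state t a w = (i t w == a)%:R.
Proof.
rewrite /state indicE; congr (nat_of_bool _)%:R; apply/idP/eqP; rewrite inE//.
Qed.

Let brv_state t a : 0 <= t -> bounded_rv (state t a).
Proof. by move=> t0; apply: bounded_rv_indic; exact: mi. Qed.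

(** Conditioning on the state at time s turns the covariance into an average of the
deviations p_ba - 1/n. *)
Lemma state_correlation : exists2 kap, 0 < kap & forall a s t, 0 <= s -> s <= t ->
  `|mean P (fun w => (state s a w - n%:R^-1) * (state t a w - n%:R^-1))| <=
    expR (- (kap * (t - s))).
Proof.
have [eta0 [M etaM] _ _] := heta.
have M0 : 0 < M by apply: lt_le_trans (etaM 0 (lexx 0)); exact: eta0.
exists M^-1 => [|a s t s0 st]; first by rewrite invr_gt0.
have t0 : 0 <= t by exact: le_trans st.
have [_ _ _ [p pP pM]] := hi.
pose A b := [set w | i s w = b]; pose B := [set w | i t w = a].
have mA b : measurable (A b) by exact: mi.
have mB : measurable B by exact: mi.
pose q b := fine (P (A b)).
have q0 b : 0 <= q b by rewrite fine_ge0.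
have q1 : \sum_b q b = 1.
  rewrite -(mean_cst P 1).
  rewrite (_ : (fun=> 1) = fun w => \sum_b state s b w).
    rewrite mean_sum; last by move=> b; exact: brv_state.
    by apply: eq_bigr => b _; rewrite /q -mean_indic.
  apply/funext => w; under eq_bigr => b _ do rewrite stateE.
  rewrite (bigD1 (i s w))//= eqxx big1 ?addr0// => b.
  by rewrite eq_sym => /negPf ->.
have AB b : mean P (\1_(A b `&` B)) = q b * p s t b a.
  rewrite mean_indic; last exact: measurableI.
  have := pM s t s0 st setT _ b a; rewrite !setTI => ->.
    by rewrite fineM// fin_num_measure//; exact: mA.
  by move=> S [[S0 SC _] _]; rewrite -[setT]setD0; exact: SC.
have -> : (fun w => (state s a w - n%:R^-1) * (state t a w - n%:R^-1)) =
    (fun w => \sum_b ((b == a)%:R - n%:R^-1) * (\1_(A b `&` B) w + (- n%:R^-1) * \1_(A b) w)).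
  apply/funext => w.
  have AE b : \1_(A b) w = (i s w == b)%:R :> R by rewrite -stateE.
  under eq_bigr => b _ do rewrite indicI /= AE.
  rewrite (bigD1 (i s w))//= eqxx big1 ?addr0 => [|b].
    by rewrite -/(state t a w) mul1r mulr1 stateE.
  by rewrite eq_sym => /negPf ->; rewrite mul0r mulr0 addr0 mulr0.
have bI b : bounded_rv (\1_(A b `&` B) : T -> R).
  by apply: bounded_rv_indic; exact: measurableI.
have bA b : bounded_rv (\1_(A b) : T -> R) by exact: bounded_rv_indic.
have bs b : bounded_rv (fun w => \1_(A b `&` B) w + (- n%:R^-1) * \1_(A b) w : R).
  by apply: bounded_rvD => //; exact: bounded_rvZ.
rewrite mean_sum; last by move=> b; exact: bounded_rvZ.
under eq_bigr => b _.
  rewrite meanZ// meanD//; last exact: bounded_rvZ.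
  rewrite meanZ// AB mean_indic// -/(q b).
  over.
apply: le_trans (ler_norm_sum _ _ _) _.
have -> : expR (- (M^-1 * (t - s))) = \sum_b q b * expR (- (M^-1 * (t - s))).
  by rewrite -mulr_suml q1 mul1r.
apply: ler_sum => b _.
rewrite (_ : _ * (_ + _) = q b * (((b == a)%:R - n%:R^-1) * (p s t b a - n%:R^-1))); last by ring.
rewrite normrM (ger0_norm (q0 b)) ler_wpM2l// normrM.
have := transition_decay n1 eta0 pP etaM s0 b a st.
apply: le_trans; rewrite ler_piMl//.
have i0 : 0 < n%:R^-1 :> R by rewrite invr_gt0 ltr0n ltnW.
have i1 : n%:R^-1 <= 1 :> R by rewrite invf_le1 ?ler1n ?ltr0n ltnW.
by rewrite ler_norml; case: eqP => _ /=; lra.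
Qed.

Let cent h a k (w : T) := centred (i ^~ w) h a k.
Let cs h a k (w : T) := csum (i ^~ w) h a k.

Let centE h a k w : cent h a k w = state (k%:R * h) a w - n%:R^-1.
Proof. by rewrite stateE. Qed.

Let n_inv0 : 0 < n%:R^-1 :> R.
Proof. by rewrite invr_gt0 ltr0n ltnW. Qed.

Let n_inv1 : n%:R^-1 <= 1 :> R.
Proof. by rewrite invf_le1 ?ler1n ?ltr0n ltnW. Qed.

Lemma bounded_rv_centred h a k : 0 < h -> bounded_rv (fun w => centred (i ^~ w) h a k).
Proof.
move=> h0; have kh : 0 <= k%:R * h by rewrite mulr_ge0// ltW.
have := bounded_rvD (brv_state a kh) (bounded_rv_cst T (- n%:R^-1)).
by congr bounded_rv; apply/funext => w; rewrite -centE.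
Qed.

Lemma bounded_rv_csum h a k : 0 < h -> bounded_rv (fun w => csum (i ^~ w) h a k).
Proof.
move=> h0; apply: bounded_rvZ; apply: bounded_rv_sum => l.
exact: bounded_rv_centred.
Qed.

(** The k-th step adds to the second moment the cross term, a geometric sum bounded by
h / kap, and the square of a step; so the moment grows linearly in k h. *)
Lemma csum_second_moment : exists2 C, 0 < C & forall h a k, 0 < h -> h <= 1 ->
  mean P (fun w => csum (i ^~ w) h a k ^+ 2) <= C * (k%:R * h).
Proof.
have [kap kap0 Hkap] := state_correlation.
exists (2 / kap + 1) => [|h a k h0 h1]; first by rewrite addr_gt0// divr_gt0.
have bX l : bounded_rv (cent h a l) by exact: bounded_rv_centred.
have bS l : bounded_rv (cs h a l) by exact: bounded_rv_csum.
have bS2 l : bounded_rv (fun w => cs h a l w ^+ 2).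
  by under eq_fun do rewrite expr2; exact: bounded_rvM.
pose G k := h * \sum_(0 <= l < k) expR (- (kap * (k%:R * h - l%:R * h))).
have G_le l : G l <= kap^-1.
  elim: l => [|l IH]; first by rewrite /G big_geq// mulr0 invr_ge0 ltW.
  have -> : G l.+1 = expR (- (kap * h)) * (G l + h).
    rewrite /G big_nat_recr//= -natr1 [in RHS]mulrDr mulrDr; congr (_ + _).
      rewrite mulrCA; congr (_ * _); rewrite mulr_sumr; apply: eq_bigr => r _.
      by rewrite -expRD; congr expR; ring.
    by rewrite mulrC; congr (expR _ * _); ring.
  apply: (@le_trans _ _ (expR (- (kap * h)) * (kap^-1 + h))).
    by rewrite ler_wpM2l ?expR_ge0// lerD2r.
  rewrite expRN ler_pdivrMl ?expR_gt0// mulrC.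
  rewrite [leLHS](_ : _ = kap^-1 * (1 + kap * h)); last by field; rewrite gt_eqF.
  by rewrite ler_wpM2l ?invr_ge0 ?(ltW kap0)// expR_ge1Dx.
have cross l : mean P (fun w => cent h a l w * cs h a l w) <= G l.
  have -> : (fun w => cent h a l w * cs h a l w) =
      (fun w => h * \sum_(0 <= r < l) cent h a r w * cent h a l w).
    apply/funext => w; rewrite /cs /csum mulrCA mulr_sumr; congr (_ * _).
    by apply: eq_bigr => r _; rewrite mulrC.
  rewrite meanZ; last by apply: bounded_rv_sum => r; exact: bounded_rvM.
  rewrite /G ler_wpM2l ?(ltW h0)// mean_sum; last by move=> r; exact: bounded_rvM.
  rewrite !big_mkord; apply: ler_sum => r _; apply: le_trans (ler_norm _) _.
  have r0 : 0 <= (r : nat)%:R * h by rewrite mulr_ge0// ltW.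
  have rl : (r : nat)%:R * h <= l%:R * h by rewrite ler_pM2r// ler_nat ltnW.
  have := Hkap a _ _ r0 rl; apply: le_trans; rewrite le_eqVlt; apply/orP; left.
  by apply/eqP; congr (`|mean P _|); apply/funext => w; rewrite !centE.
elim: k => [|k IH].
  rewrite (_ : (fun w => _) = fun=> 0) ?mean_cst ?mul0r ?mulr0//.
  by apply/funext => w; rewrite /csum big_geq// mulr0 expr0n.
have -> : (fun w => csum (i ^~ w) h a k.+1 ^+ 2) =
    (fun w => cs h a k w ^+ 2 + (2 * h * (cent h a k w * cs h a k w) +
      h ^+ 2 * (cent h a k w * cent h a k w))).
  apply/funext => w.
  have -> : csum (i ^~ w) h a k.+1 = cs h a k w + h * cent h a k w.
    by rewrite /cs /csum big_nat_recr//= mulrDr.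
  ring.
have bXS : bounded_rv (fun w => cent h a k w * cs h a k w) by exact: bounded_rvM.
have bXX : bounded_rv (fun w => cent h a k w * cent h a k w) by exact: bounded_rvM.
rewrite meanD//; last by apply: bounded_rvD; exact: bounded_rvZ.
rewrite meanD; [|exact: bounded_rvZ|exact: bounded_rvZ].
rewrite meanZ// meanZ//.
have X1 : mean P (fun w => cent h a k w * cent h a k w) <= 1.
  rewrite -[leRHS](mean_cst P); apply: mean_le => //; first exact: bounded_rv_cst.
  by move=> w; rewrite centE stateE; move: n_inv0 n_inv1; set u := n%:R^-1; case: eqP => _ /=; nra.
have c1 := le_trans (cross k) (G_le k).
rewrite [leRHS](_ : _ = (2 / kap + 1) * (k%:R * h) + (2 * h * kap^-1 + h)); last first.
  by rewrite -[k.+1%:R]natr1; ring.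
apply: lerD; first exact: IH.
apply: lerD; first by rewrite ler_wpM2l// mulr_ge0// ltW.
by apply: le_trans (ler_wpM2l (sqr_ge0 h) X1) _; nra.
Qed.

(** With th^2 = 1 + k h, the inequality |s| <= s^2 / (2 th) + th / 2 passes from the
second to the first moment. *)
Lemma csum_first_moment : exists2 C, 0 < C & forall h a k, 0 < h -> h <= 1 ->
  mean P (fun w => `|csum (i ^~ w) h a k|) <= C * Num.sqrt (1 + k%:R * h).
Proof.
have [C C0 HC] := csum_second_moment.
exists ((C + 1) / 2) => [|h a k h0 h1]; first by rewrite divr_gt0// addr_gt0.
have kh : 0 <= k%:R * h by rewrite mulr_ge0// ltW.
set th := Num.sqrt _; have th0 : 0 < th by rewrite sqrtr_gt0; lra.
have th2 : th ^+ 2 = 1 + k%:R * h by rewrite sqr_sqrtr//; lra.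
have bS : bounded_rv (cs h a k) by exact: bounded_rv_csum.
have bS2 : bounded_rv (fun w => cs h a k w ^+ 2).
  by under eq_fun do rewrite expr2; exact: bounded_rvM.
apply: (@le_trans _ _ (mean P (fun w => (2 * th)^-1 * cs h a k w ^+ 2 + th / 2))).
  apply: mean_le; first exact: bounded_rv_norm.
    by apply: bounded_rvD; [exact: bounded_rvZ|exact: bounded_rv_cst].
  move=> w; rewrite -/(cs h a k w) -(real_normK (num_real (cs h a k w))).
  set s := `|_|; rewrite -subr_ge0.
  rewrite [leRHS](_ : _ = (2 * th)^-1 * (s - th) ^+ 2); last by field; rewrite gt_eqF.
  by rewrite mulr_ge0 ?sqr_ge0// invr_ge0 mulr_ge0// ltW.
rewrite meanD; [|exact: bounded_rvZ|exact: bounded_rv_cst].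
rewrite meanZ// mean_cst.
have := HC h a k h0 h1; rewrite -/(mean P (fun w => cs h a k w ^+ 2)).
set m2 := mean _ _ => Hm.
have H1 : m2 <= C * th ^+ 2.
  by apply: le_trans Hm _; rewrite th2 ler_wpM2l ?(ltW C0)//; lra.
apply: (@le_trans _ _ ((2 * th)^-1 * (C * th ^+ 2) + th / 2)).
  by rewrite lerD2r ler_wpM2l// invr_ge0 mulr_ge0// ltW.
by rewrite le_eqVlt; apply/orP; left; apply/eqP; field; rewrite gt_eqF.
Qed.

Lemma bounded_rv_noise_weight h a m : 0 < h ->
  bounded_rv (fun w => noise_weight (i ^~ w) h a m).
Proof.
move=> h0; have bn k : bounded_rv (fun w => `|csum (i ^~ w) h a k|).
  by apply: bounded_rv_norm; exact: bounded_rv_csum.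
apply: bounded_rvD; first exact: bounded_rvZ.
by apply: bounded_rv_sum => k; exact: bounded_rvZ.
Qed.

(** The first moment of csum cancels one power of decay; what remains is a Riemann
sum of 1/(1+s), compared with the logarithm cell by cell. *)
Lemma noise_weight_mean : exists2 C, 0 < C & forall h a m, 0 < h -> h <= 1 ->
  mean P (fun w => noise_weight (i ^~ w) h a m) <= C * (1 + ln (1 + m%:R * h)).
Proof.
have [C C0 HC] := csum_first_moment.
exists (4 * C) => [|h a m h0 h1]; first by rewrite mulr_gt0.
have kh k : 0 <= k%:R * h by rewrite mulr_ge0// ltW.
have bn k : bounded_rv (fun w => `|csum (i ^~ w) h a k|).
  by apply: bounded_rv_norm; exact: bounded_rv_csum.
rewrite /noise_weight meanD; last 2 first.
- exact: bounded_rvZ.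
- by apply: bounded_rv_sum => k; exact: bounded_rvZ.
rewrite meanZ// mean_sum; last by move=> k; exact: bounded_rvZ.
have lnS k : h * decay (k%:R * h) ^+ 2 <= 2 * (ln (1 + k.+1%:R * h) - ln (1 + k%:R * h)).
  rewrite decay_sqr//.
  have -> : 1 + k.+1%:R * h = 1 + k%:R * h + h by rewrite -[k.+1%:R]natr1; ring.
  have := kh k; set u := 1 + k%:R * h => kh0.
  have u1 : 1 <= u by rewrite /u; lra.
  have u0 : 0 < u by lra.
  have uh0 : 0 < u + h by lra.
  have : ln (u / (u + h)) <= u / (u + h) - 1.
    have uuh : 0 < u / (u + h) by rewrite divr_gt0.
    rewrite -[X in ln X](subrKC 1) le_ln1Dx//; lra.
  rewrite ln_div ?posrE// => Hln.
  have : h / (u + h) <= ln (u + h) - ln u.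
    rewrite -lerN2 opprB; apply: le_trans Hln _.
    by rewrite le_eqVlt; apply/orP; left; apply/eqP; field; rewrite gt_eqF.
  have : h / u <= 2 * (h / (u + h)).
    rewrite ler_pdivrMr// [leRHS](_ : _ = h * (2 * u / (u + h))); last by field; rewrite gt_eqF.
    by rewrite ler_peMr ?(ltW h0)// ler_pdivlMr//; lra.
  lra.
have term k : mean P (fun w => h * decay (k%:R * h) ^+ 3 * `|csum (i ^~ w) h a k.+1|) <=
    4 * C * (ln (1 + k.+1%:R * h) - ln (1 + k%:R * h)).
  rewrite meanZ//; have dk := decay_gt0 (kh k).
  apply: (@le_trans _ _ (h * decay (k%:R * h) ^+ 3 * (C * (2 / decay (k%:R * h))))).
    rewrite ler_wpM2l ?mulr_ge0 ?exprn_ge0 ?(ltW h0) ?(ltW dk)//.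
    apply: le_trans (HC h a k.+1 h0 h1) _; rewrite ler_wpM2l ?(ltW C0)//.
    rewrite /decay invrK -ler_sqr ?nnegrE ?mulr_ge0 ?sqrtr_ge0// exprMn !sqr_sqrtr.
    - by rewrite -[k.+1%:R]natr1 mulrDl; have := kh k; lra.
    - by have := kh k; lra.
    - by have := kh k.+1; lra.
  rewrite [leLHS](_ : _ = 2 * C * (h * decay (k%:R * h) ^+ 2)); last by field; rewrite gt_eqF.
  by have := ler_wpM2l (ltW C0) (lnS k); lra.
have := HC h a m h0 h1; set e1 := mean _ _ => He1.
rewrite mulrDr mulr1; apply: lerD.
  apply: (@le_trans _ _ C); last by lra.
  have dm := decay_gt0 (kh m); apply: le_trans (ler_wpM2l (ltW dm) He1) _.
  by rewrite mulrCA mulVf ?mulr1// -invr_eq0 gt_eqF.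
apply: (@le_trans _ _ (\sum_(0 <= k < m) 4 * C * (ln (1 + k.+1%:R * h) - ln (1 + k%:R * h)))).
  by rewrite !big_mkord; apply: ler_sum => k _; exact: term.
rewrite -mulr_sumr (telescope_sumr (fun k : nat => ln (1 + k%:R * h)))//.
by rewrite mul0r addr0 ln1 subr0.
Qed.

End Chain.

(** * Pathwise bound on the error *)

Lemma enorm_le_norm (R : realType) n (v : 'cV[R]_n) : enorm v <= n%:R * `|v|.
Proof.
rewrite -ler_sqr ?nnegrE ?mulr_ge0 ?sqrtr_ge0// enorm_sqr -/(dotp v v).
apply: le_trans (ler_norm _) _; apply: le_trans (ler_dotp _ _) _.
rewrite -expr2 exprMn ler_wpM2r ?sqr_ge0// -natrX ler_nat.
by case: n v => [//|n] v; rewrite -{1}[n.+1]muln1 -mulnn leq_mul2l.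
Qed.

Section FlowEstimate.
Variables (R : realType) (n N Nsub : nat).
Hypothesis N1 : (1 < N)%N.
Variables (H : 'I_Nsub -> 'M[R]_n) (b : 'I_Nsub -> 'cV[R]_n).
Variable lam : R.
Hypotheses (lam0 : 0 < lam) (Hsym : forall a, (H a)^T = H a).
Hypothesis Hlam : forall a v, lam * `|v| ^+ 2 <= dotp v (H a *m v).
Variables (x0 : 'I_N -> 'cV[R]_n) (ts : 'cV[R]_n) (j : 'I_N).
Hypothesis ts_affine : ens_affine x0 ts.
Hypothesis ts_opt : forall v : 'cV[R]_n, (v^T <= ens_span x0)%MS ->
  dotp v (\sum_a (H a *m ts - b a)) = 0.

Local Notation c1 := ((N.-1)%:R^-1 : R).

Lemma deviation_in_span l : ((x0 l - ens_mean x0)^T <= ens_span x0)%MS.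
Proof.
rewrite (_ : _^T = row l (ens_span x0)) ?row_sub//.
by apply/rowP => p; rewrite !mxE.
Qed.

(** Both the particle and the optimum lie in the affine ensemble space, so their
difference lies in its direction, which the initial deviations span. *)
Lemma initial_error_coordinates : exists c0 : 'I_N -> R,
  x0 j - ts = \sum_l c0 l *: (x0 l - ens_mean x0).
Proof.
have : ((x0 j - ts)^T <= ens_span x0)%MS.
  have -> : x0 j - ts = (x0 j - ens_mean x0) +
      ((ens_mean x0 - ens_perp x0) - (ts - ens_perp x0)).
    move: (ens_mean x0) (ens_perp x0) => m p.
    by apply/colP => q; rewrite !mxE; ring.
  rewrite linearD /= addmx_sub ?deviation_in_span//.
  rewrite linearB /= addmx_sub ?eqmx_opp//.
  rewrite /ens_perp opprB addrC subrK /ens_proj trmxK.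
  by rewrite (submx_trans (proj_mx_sub _ _ _))// genmxE.
move=> /submxP[u uE]; exists (fun l => u 0 l).
rewrite -[LHS]trmxK uE; apply/colP => p; rewrite !mxE summxE.
by apply: eq_bigr => l _; rewrite !mxE.
Qed.

(** The constant B serves all paths at once; only the grid error K depends on the
path. This uniformity is what allows expectations to be taken. *)
Lemma flow_estimate : exists2 B, 0 <= B &
  forall i x, flow H b x0 i x -> forall t, 0 < t -> exists K, forall m, (0 < m)%N ->
    enorm (x t j - ts) <=
      B * decay t * (1 + \sum_a noise_weight i (t / m%:R) a m) + K / m%:R.
Proof.
have [D D0 HD] := deviation_decay N1 b lam0 Hsym Hlam x0.
have [V V0 HV] := velocity_decay N1 b lam0 Hsym Hlam x0.
have [c0 c0E] := initial_error_coordinates.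
have c10 : 0 <= c1 by rewrite invr_ge0.
pose gam a := H a *m ts - b a.
pose g := \sum_a `|gam a|.
have g0 : 0 <= g by rewrite sumr_ge0.
have gamg a : `|gam a| <= g by rewrite /g (bigD1 a)//= lerDl sumr_ge0.
pose B1 := c1 * (n%:R * (g * (D + V))).
have B10 : 0 <= B1 by rewrite !mulr_ge0// addr_ge0.
pose S0 := \sum_l `|c0 l|.
have S00 : 0 <= S0 by rewrite sumr_ge0.
pose B := n%:R * (D * (S0 + N%:R * B1)).
exists B; first by rewrite !mulr_ge0// addr_ge0// mulr_ge0.
move=> i x ix t t0.
have [cad x0' cx _] := ix.
have [c [c_0 cc dc cE]] := ensemble_coordinates N1 lam0 Hsym Hlam ix c0E.
pose dpsi l a s := c1 * dotp (gam a)
  (- (ens_cov (x s) *m (H (i s) *m deviation x s l))).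
have noiseB l a s : 0 <= s -> `|noise H b ts x l a s| <= B1 * decay s.
  move=> s0; have ds := ltW (decay_gt0 s0).
  rewrite /noise normrM ger0_norm// /B1 -!mulrA ler_wpM2l//.
  apply: le_trans (ler_dotp _ _) _; rewrite ler_wpM2l//; apply: ler_pM => //; first exact: gamg.
  apply: le_trans (HD _ _ ix _ _ s0) _.
  by rewrite ler_wpM2r// lerDl.
have dnoiseB l a s : 0 < s -> `|dpsi l a s| <= B1 * decay s ^+ 3.
  move=> s0; have ds := ltW (decay_gt0 (ltW s0)).
  rewrite /dpsi normrM ger0_norm// /B1 -!mulrA ler_wpM2l//.
  apply: le_trans (ler_dotp _ _) _; rewrite ler_wpM2l//; apply: ler_pM => //.
  rewrite normrN.
  apply: le_trans (HV _ _ ix _ _ (ltW s0)) _.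
  by rewrite ler_wpM2r ?exprn_ge0// lerDr.
have cnoise l a : continuous (noise H b ts x l a).
  move=> s; apply: cvgM; first exact: cvg_cst.
  have cd := @continuous_dotp _ _ _ (gam a) _ (@continuous_deviation _ _ _ _ _ _ _ _ _ ix l) s.
  exact: cd.
have dnoise l a s : 0 < s -> regular i s ->
    is_derive s 1 (noise H b ts x l a) (dpsi l a s).
  move=> s0 rs; apply: (is_derive_scalef (V := R)); apply: is_derive_dotp.
  exact: (is_derive_deviation N1 ix l s0 rs).
have noise0 l s : 0 <= s -> \sum_a noise H b ts x l a s = 0.
  move=> s0; rewrite /noise -mulr_sumr.
  under eq_bigr => a _ do rewrite dotpC.
  rewrite -dotp_sumr dotpC.
  rewrite (deviation_orthogonal N1 lam0 Hsym Hlam ix) ?mulr0// => k.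
  by rewrite dotpC ts_opt// /deviation x0' deviation_in_span.
have [K HK] := choice (fun l => path_estimate cad B10 t0 (cc l) (fun s s0 rs => dc s s0 rs l)
  (cnoise l) (dnoise l) (noiseB l) (dnoiseB l) (noise0 l)).
exists (n%:R * (D * decay t * \sum_l K l)) => m m0.
have dt := ltW (decay_gt0 (ltW t0)).
set W := \sum_a noise_weight _ _ _ _.
have W0 : 0 <= W.
  apply: sumr_ge0 => a _; rewrite /noise_weight addr_ge0//.
    by rewrite mulr_ge0// invr_ge0 sqrtr_ge0.
  by apply: sumr_ge0 => k _; rewrite !mulr_ge0 ?exprn_ge0 ?invr_ge0 ?sqrtr_ge0// ltW.
apply: le_trans (enorm_le_norm _) _.
apply: (@le_trans _ _ (n%:R * (D * decay t * \sum_l `|c t l|))).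
  rewrite ler_wpM2l// cE; last exact: ltW.
  apply: le_trans (ler_norm_sum _ _ _) _; rewrite mulr_sumr; apply: ler_sum => l _.
  by rewrite normrZ mulrC ler_wpM2r// (HD _ _ ix)// ltW.
have csum_le : \sum_l `|c t l| <= S0 + N%:R * B1 * W + (\sum_l K l) / m%:R.
  apply: (@le_trans _ _ (\sum_l (`|c0 l| + B1 * W + K l / m%:R))).
    by apply: ler_sum => l _; have := HK l m m0; rewrite c_0.
  rewrite !big_split /= sumr_const card_ord -mulr_suml lerD2r lerD2l.
  by rewrite -[_ *+ N]mulr_natl mulrA.
apply: le_trans (ler_wpM2l _ (ler_wpM2l _ csum_le)) _ => //; first by rewrite mulr_ge0.
rewrite [leLHS](_ : _ = n%:R * (D * decay t) * (S0 + N%:R * B1 * W) +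
  n%:R * (D * decay t * \sum_l K l) / m%:R); last by ring.
rewrite lerD2r /B [leRHS](_ : _ = n%:R * (D * decay t) * ((S0 + N%:R * B1) * (1 + W))); last by ring.
rewrite ler_wpM2l ?mulr_ge0//.
have := mulr_ge0 S00 W0; have : 0 <= N%:R * B1 by rewrite mulr_ge0.
by lra.
Qed.

End FlowEstimate.

(** * Couplings with a Dirac measure *)

Section BorelColumn.
Variables (R : realType) (n : nat).
Local Notation B := (borel_cV R n).

Lemma measurable_coord k : measurable_fun setT (fun z : B => (z : 'cV[R]_n) k 0).
Proof.
apply: (measurability _ (RGenOInfty.measurableE R)) => _ [_ [x ->] <-].
rewrite setTI; apply: sub_sigma_algebra.
rewrite (_ : _ @^-1` _ = (fun z : 'cV[R]_n => z k 0) @^-1` [set` `]x, +oo[]) //.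
apply: open_comp; last exact: rray_open.
by move=> z _; exact: coord_continuous.
Qed.

Lemma measurable_enorm_sub d (T : measurableType d) (f g : T -> B) :
  measurable_fun setT f -> measurable_fun setT g ->
  measurable_fun setT (fun w => enorm (f w - g w : 'cV[R]_n)).
Proof.
move=> mf mg; rewrite /enorm.
apply: (@measurableT_comp _ _ _ _ _ _ (@Num.sqrt R)).
  by apply: continuous_measurable_fun; exact: sqrt_continuous.
apply: measurable_sum => k.
have mk : measurable_fun setT (fun w => (f w : 'cV[R]_n) k 0 - (g w : 'cV[R]_n) k 0).
  by apply: measurable_funB;
    [exact: (measurableT_comp (measurable_coord k) mf)|exact: (measurableT_comp (measurable_coord k) mg)].
rewrite (_ : (fun _ => _) = fun w => ((f w : 'cV[R]_n) k 0 - (g w : 'cV[R]_n) k 0) ^+ 2).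
  exact: measurable_funX.
by apply/funext => w; rewrite !mxE.
Qed.

Definition cost q (x y : 'cV[R]_n) : R := Num.min 1 (enorm (x - y) `^ q).

Lemma measurable_cost q d (T : measurableType d) (f g : T -> B) :
  measurable_fun setT f -> measurable_fun setT g ->
  measurable_fun setT (fun w => cost q (f w) (g w)).
Proof.
move=> mf mg; apply: measurable_minr; first exact: measurable_cst.
apply: (@measurableT_comp _ _ _ _ _ _ (@powR R ^~ q)); first exact: measurable_powR.
exact: measurable_enorm_sub.
Qed.

Lemma cost_ge0 q x y : 0 <= cost q x y.
Proof. by rewrite le_min ler01 powR_ge0. Qed.

Lemma wasserstein_ge0 q pi pi' : (0 <= @wasserstein R n q pi pi')%E.
Proof.
apply: le_ereal_inf_tmp => _ [H _ <-]; apply: integral_ge0 => z _.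
by rewrite lee_fin; exact: cost_ge0.
Qed.

(** The coupling is the law of (z, X) under the conditional probability, which is
bounded by P divided by the probability of the condition. *)
Lemma wasserstein_dirac_le d (T : measurableType d) (P : probability T R)
    (E : set T) (X : T -> B) (z : 'cV[R]_n) q :
  measurable E -> P E != 0%E -> measurable_fun setT X ->
  (wasserstein q (@dirac _ B z R) (pushforward (cond_prob P E) X) <=
   ((fine (P E))^-1 * mean P (fun w => cost q z (X w)))%:E)%E.
Proof.
move=> mE PE0 mX.
have PEfin : P E \is a fin_num by exact: fin_num_measure.
have pE0 : 0 < fine (P E).
  by rewrite fine_gt0// lt0e PE0 measure_ge0/= ltey_eq PEfin.
pose Q : probability T R := mnormalize (mrestr P mE) P.
have QE A : Q A = (P (A `&` E) * ((fine (P E))^-1)%:E)%E.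
  rewrite /Q /= /mnormalize /= /mrestr setTI (negPf PE0) /=.
  by have /negPf -> : P E != +oo%E by move: PEfin; rewrite fin_numE => /andP[].
pose phi w : B * B := ((z : B), X w).
have mphi : measurable_fun setT phi.
  by apply: measurable_fun_pair; first exact: measurable_cst.
pose H : probability (B * B)%type R := distribution Q (mfun_Sub (mem_set mphi)).
have HE A : H A = Q (phi @^-1` A) by [].
apply: (@le_trans _ _ (\int[H]_u (cost q u.1 u.2)%:E)%E).
  apply: ereal_inf_lbound; exists H => //.
  move=> A mA; split; rewrite HE.
    rewrite diracE; have [zA|zA] := boolP (z \in A).
      rewrite (_ : _ @^-1` _ = setT); first exact: probability_setT.
      by apply/seteqP; split => // w _; split => //=; exact: set_mem.
    rewrite (_ : _ @^-1` _ = set0) ?measure0//.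
    by apply/seteqP; split => // w -[/= /mem_set]; rewrite (negPf zA).
  rewrite QE /pushforward /cond_prob (_ : phi @^-1` _ = X @^-1` A)//.
  by apply/seteqP; split => w //= [].
have bc : bounded_rv (fun w => cost q z (X w)).
  split; first by apply: measurable_cost => //; exact: measurable_cst.
  by exists 1 => w; rewrite ger0_norm ?cost_ge0// ge_min lexx.
rewrite ge0_integral_distribution//=; last 2 first.
- by apply/measurable_EFinP; apply: measurable_cost; [exact: measurable_fst|exact: measurable_snd].
- by move=> u; rewrite lee_fin cost_ge0.
have k0 : 0 <= (fine (P E))^-1 by rewrite invr_ge0 ltW.
pose kk := NngNum k0.
apply: (@le_trans _ _ (\int[mscale kk P]_w (cost q z (X w))%:E)%E).
  apply: ge0_le_measure_integral => //.
  - move=> A mA; rewrite [leLHS]QE /mscale /= muleC; apply: lee_wpmul2l => //.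
    by apply: le_measure; rewrite ?inE//; exact: measurableI.
  - by move=> w; rewrite lee_fin cost_ge0.
  - by apply/measurable_EFinP; case: bc.
rewrite ge0_integral_mscale//.
- by rewrite mean_EFin.
- by apply/measurable_EFinP; case: bc.
- by move=> w _; rewrite lee_fin cost_ge0.
Qed.

End BorelColumn.

(** * Passing to the limit *)

(** Dominated convergence for min(Z, Y_m), which is bounded by Z and tends to it. *)
Lemma mean_le_of_approx (R : realType) d (T : measurableType d)
    (P : probability T R) (Z : T -> R) (Y : nat -> T -> R) (beta : R) :
  bounded_rv Z -> (forall m, bounded_rv (Y m)) ->
  (forall w, 0 <= Z w) -> (forall m w, 0 <= Y m w) ->
  {ae P, forall w, exists K, forall m, Z w <= Y m w + K / m.+1%:R} ->
  (\forall m \near \oo, mean P (Y m) <= beta) ->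
  mean P Z <= beta.
Proof.
move=> bZ bY Z0 Y0 ZY Ybeta.
pose Zm m w := Num.min (Z w) (Y m w).
have bZm m : bounded_rv (Zm m).
  split; first by apply: measurable_minr; [case: bZ|case: (bY m)].
  have [_ [M ZM]] := bZ; exists M => w; apply: le_trans (ZM w).
  by rewrite !ger0_norm ?le_min ?Z0 ?Y0// ge_min lexx.
have [|||||_ _] := @dominated_convergence _ _ R P setT measurableT
    (fun m w => (Zm m w)%:E) (EFin \o Z) (EFin \o Z).
- by move=> m; apply/measurable_EFinP; case: (bZm m).
- by apply/measurable_EFinP; case: bZ.
- apply: filterS ZY => w [K HK] _ /=.
  apply: cvg_EFin; first exact: nearW.
  apply/cvgrPdist_le => e e0.
  near=> m.
  have Ke : K / m.+1%:R <= e.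
    have m1 : 0 < m.+1%:R :> R by [].
    rewrite ler_pdivrMr// -ler_pdivrMl//.
    apply: (@le_trans _ _ m%:R); last by rewrite ler_nat.
    near: m; exact: nbhs_infty_ger.
  rewrite /Zm /= ger0_norm ?subr_ge0 ?ge_min ?lexx//.
  rewrite lerBlDl -lerBlDr le_min.
  apply/andP; split; first by rewrite lerBlDr lerDl ltW.
  by rewrite lerBlDr (le_trans (HK m))// lerD2l.
- exact: bounded_rv_integrable.
- apply: aeW => w m _ /=; rewrite lee_fin ger0_norm ?le_min ?Z0 ?Y0//.
  by rewrite ge_min lexx.
rewrite (_ : (fun n => _) = fun m => (mean P (Zm m))%:E); last first.
  by apply/funext => m; rewrite mean_EFin.
rewrite (mean_EFin P bZ) => cvgZ.
rewrite -lee_fin -(cvg_lim _ cvgZ)//; apply: lime_le; first by apply/cvg_ex; exists (mean P Z)%:E.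
apply: filterS Ybeta => m mb; rewrite lee_fin (le_trans _ mb)//.
by apply: mean_le => // w; rewrite ge_min lexx orbT.
Unshelve. all: by end_near. Qed.

(** Controls the cost by the mean of the truncated distance, one small e at a time. *)
Lemma min_powR_le (R : realType) (q e x : R) : 0 < q <= 1 -> 0 < e -> e <= 1 -> 0 <= x ->
  Num.min 1 (x `^ q) <= e `^ q + Num.min 1 x / e.
Proof.
move=> /andP[q0 q1] e0 e1 x0.
have [xe|ex] := leP x e.
  rewrite ge_min; apply/orP; right; rewrite -[leLHS]addr0 lerD//.
    by rewrite ge0_ler_powR// ?nnegrE// ltW.
  by rewrite divr_ge0 ?le_min ?ler01// ltW.
rewrite ge_min; apply/orP; left; rewrite -[leLHS]add0r lerD ?powR_ge0//.
by rewrite ler_pdivlMr// mul1r le_min e1 ltW.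
Qed.

(** With r the fourth root of 1 + t, the left-hand side is at most 5 C / r. *)
Lemma decay_ln_small (R : realType) (C del : R) : 0 < C -> 0 < del ->
  \forall t \near +oo, C * (decay t * (1 + ln (1 + t))) <= del.
Proof.
move=> C0 del0; near=> t.
have t0 : 0 <= t by near: t; exact: nbhs_pinfty_ge.
pose r := Num.sqrt (Num.sqrt (1 + t)).
have r1 : 1 <= r.
  rewrite -[leLHS]sqrtr1 ler_wsqrtr// -[leLHS]sqrtr1 ler_wsqrtr//; lra.
have r0 : 0 < r by lra.
have r2 : r ^+ 2 = Num.sqrt (1 + t) by rewrite sqr_sqrtr// sqrtr_ge0.
have r4 : r ^+ 4 = 1 + t by rewrite (exprM _ 2 2) r2 sqr_sqrtr//; lra.
have lnr : ln (1 + t) <= 4 * r.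
  by rewrite -r4 lnXn// [leRHS]mulr_natl lerMn2r /= ltW// ln_sublinear.
have decr : decay t = (r ^+ 2)^-1 by rewrite r2.
apply: (@le_trans _ _ (C * ((r ^+ 2)^-1 * (r + 4 * r)))).
  rewrite decr ler_wpM2l ?(ltW C0)// ler_wpM2l ?invr_ge0 ?exprn_ge0 ?(ltW r0)//.
  by rewrite lerD.
rewrite [leLHS](_ : _ = 5 * C / r); last by field; rewrite gt_eqF.
rewrite ler_pdivrMr// -ler_pdivrMl// mulrC.
set D := _ / _; have D0 : 0 < D by rewrite divr_gt0// mulr_gt0.
rewrite -(@ler_pXn2r _ 4)// ?nnegrE ?(ltW D0) ?(ltW r0)// r4.
apply: (@le_trans _ _ t); last by lra.
by near: t; apply: nbhs_pinfty_ge; exact: num_real.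
Unshelve. all: by end_near. Qed.

(** * Decay of the mean error and convergence *)

Section Error.
Variables (R : realType) (Nsub Nens : nat).
Hypotheses (hNsub : (2 <= Nsub)%N) (hNens : (2 <= Nens)%N).
Variables (k : 'I_Nsub -> nat) (A : forall i : 'I_Nsub, 'M[R]_(k i, Nens)).
Variables (y : forall i : 'I_Nsub, 'cV[R]_(k i)) (alpha : R) (C0 : 'M[R]_Nens).
Hypotheses (halpha : 0 < alpha) (hC0 : posdefmx C0).
Variables (theta0 : 'I_Nens -> 'cV[R]_Nens) (thetastar : 'cV[R]_Nens).
Hypothesis hstar : argmin (ens_affine theta0) (Phi_reg A y alpha C0) thetastar.
Variables (eta : R -> R) (heta : learning_rate eta).
Variables (d : measure_display) (T : measurableType d) (P : probability T R).
Variables (i : R -> T -> 'I_Nsub) (hi : index_process P eta i).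
Variable theta : R -> 'I_Nens -> T -> borel_cV R Nens.
Hypothesis htheta : subsampling_TEKI_solution P
  (fun a => Phi_reg_sub A y alpha C0 a) i theta0 theta.

Let H a := sub_hess A alpha C0 a.
Let b a := (A a)^T *m y a.
Let Nsub0 : (0 < Nsub)%N. Proof. exact: ltnW. Qed.
Let alphaN0 : 0 < alpha / Nsub%:R. Proof. by rewrite divr_gt0// ltr0n. Qed.

Let H_coercive : exists2 lam, 0 < lam & forall a v, lam * `|v| ^+ 2 <= dotp v (H a *m v).
Proof.
have [lam lam0 Hlam] := posdefmx_coercive (posdefmxZ alphaN0 hC0).
exists lam => // a v; rewrite /H /sub_hess mulmxDl dotpDr -mulmxA dotp_mulmxr trmxK.
by apply: le_trans (Hlam v) _; rewrite lerDr dotp_self_ge0.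
Qed.

Let solution_flow : {ae P, forall w,
  flow H b theta0 (i ^~ w) (fun s l => theta (Num.max 0 s) l w)}.
Proof.
have [_ cad _ _] := hi; have [_] := htheta.
apply: filterS => w /= [x0 cx dx]; split => //.
- by rewrite maxxx.
- move=> l; apply: (continuous_comp_within (cx l)) => [|s].
    have : continuous (cst 0 \max id : R -> R^o).
      by move=> r; apply: continuous_max; [exact: cvg_cst|exact: cvg_id].
    exact.
  by rewrite /= in_itv/= le_max lexx.
- move=> t t0 rt l.
  have := dx t t0 rt l; rewrite grad_Phi_reg_sub// /sub_grad -/(H _) -/(b _).
  have -> : Num.max 0 t = t by apply/max_idPr; exact: ltW.
  apply: is_derive_near; near=> s; congr (theta _ l w); apply/esym/max_idPr.
  by apply: ltW; near: s; exact: lt_nbhsr.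
Unshelve. all: by end_near. Qed.

(** Averages the pathwise bound over the law of the index process, then lets the
mesh of the grid tend to 0. *)
Lemma mean_error_decay j : exists2 C, 0 < C & forall t, 0 < t ->
  mean P (fun w => Num.min 1 (enorm (thetastar - theta t j w : 'cV[R]_Nens))) <=
    C * (decay t * (1 + ln (1 + t))).
Proof.
have [lam lam0 Hlam] := H_coercive.
have ts_opt (v : 'cV[R]_Nens) : (v^T <= ens_span theta0)%MS ->
    dotp v (\sum_a (H a *m thetastar - b a)) = 0.
  exact: (sum_sub_grad_orthogonal halpha hC0 Nsub0 hstar).
have [B B0 HB] := flow_estimate hNens lam0 (sub_hess_sym A alpha hC0) Hlam j
  (proj1 hstar) ts_opt.
have [C1 C10 HC1] := noise_weight_mean hNsub heta hi.
pose C := B * (1 + Nsub%:R * C1).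
have C_ge0 : 0 <= C by rewrite mulr_ge0// addr_ge0// mulr_ge0// ltW.
(* B may vanish, so 1 is added to get a positive constant. *)
exists (C + 1) => [|t t0]; first by lra.
have t0' := ltW t0.
have [mtheta _] := htheta.
pose h m : R := t / m.+1%:R.
have h0 m : 0 < h m by rewrite divr_gt0.
pose Y m w := B * decay t * (1 + \sum_a noise_weight (i ^~ w) (h m) a m.+1).
pose Z w := Num.min 1 (enorm (thetastar - theta t j w : 'cV[R]_Nens)).
have bZ : bounded_rv Z.
  split; last by exists 1 => w; rewrite ger0_norm ?ge_min ?lexx// le_min ler01 sqrtr_ge0.
  apply: measurable_minr; first exact: measurable_cst.
  by apply: measurable_enorm_sub; [exact: measurable_cst|exact: mtheta].
have bW m : bounded_rv (fun w => \sum_a noise_weight (i ^~ w) (h m) a m.+1).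
  by apply: bounded_rv_sum => a; apply: (bounded_rv_noise_weight hi).
have bY m : bounded_rv (Y m).
  by apply: bounded_rvZ; apply: bounded_rvD => //; exact: bounded_rv_cst.
have nw0 x u a m : 0 < u -> 0 <= @noise_weight R Nsub x u a m.
  move=> u0; rewrite /noise_weight addr_ge0 ?mulr_ge0 ?invr_ge0 ?sqrtr_ge0//.
  by apply: sumr_ge0 => l _; rewrite !mulr_ge0 ?exprn_ge0 ?invr_ge0 ?sqrtr_ge0// ltW.
have dt := decay_gt0 t0'.
have ln0 : 0 <= ln (1 + t) by rewrite ln_ge0//; lra.
apply: (@mean_le_of_approx _ _ _ P Z Y) => //.
- by move=> w; rewrite le_min ler01 sqrtr_ge0.
- move=> m w; rewrite mulr_ge0 ?mulr_ge0 ?(ltW dt)// addr_ge0// sumr_ge0// => a _.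
  exact: nw0.
- apply: filterS solution_flow => w ix.
  have [K HK] := HB _ _ ix t t0; exists K => m.
  have := HK m.+1 isT; apply: le_trans; rewrite ge_min; apply/orP; right.
  have -> : Num.max 0 t = t by apply/max_idPr.
  rewrite /enorm; apply: ler_wsqrtr; rewrite le_eqVlt; apply/orP; left; apply/eqP.
  by apply: eq_bigr => p _; rewrite !mxE -sqrrN opprB.
- near=> m.
  have hm1 : h m <= 1.
    rewrite ler_pdivrMr// mul1r; apply: (@le_trans _ _ m%:R); last by rewrite ler_nat.
    near: m; exact: nbhs_infty_ger.
  rewrite /Y meanZ; last by apply: bounded_rvD => //; exact: bounded_rv_cst.
  rewrite meanD//; last exact: bounded_rv_cst.
  rewrite mean_cst mean_sum; last by move=> a; apply: (bounded_rv_noise_weight hi).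
  have mh : m.+1%:R * h m = t by rewrite mulrC divfK.
  have sum_le : \sum_a mean P (fun w => noise_weight (i ^~ w) (h m) a m.+1) <=
      Nsub%:R * (C1 * (1 + ln (1 + t))).
    rewrite -[Nsub in Nsub%:R]card_ord mulr_natl -sumr_const; apply: ler_sum => a _.
    by have := HC1 (h m) a m.+1 (h0 m) hm1; rewrite mh.
  apply: (@le_trans _ _ (B * decay t * (1 + Nsub%:R * (C1 * (1 + ln (1 + t)))))).
    by rewrite ler_wpM2l ?mulr_ge0 ?(ltW dt)// lerD2l.
  have NC : 0 <= Nsub%:R * C1 by rewrite mulr_ge0// ltW.
  rewrite [leRHS](_ : _ = decay t * ((C + 1) * (1 + ln (1 + t)))); last by ring.
  rewrite [leLHS](_ : _ = decay t * (B * (1 + Nsub%:R * C1 * (1 + ln (1 + t))))); last by ring.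
  rewrite ler_wpM2l ?(ltW dt)// /C.
  have := mulr_ge0 B0 ln0; have := mulr_ge0 B0 NC; nra.
Unshelve. all: by end_near. Qed.

End Error.

Theorem theorem4p3 (R : realType) (Nsub Nens : nat)
  (hNsub : (2 <= Nsub)%N) (hNens : (2 <= Nens)%N)
  (k : 'I_Nsub -> nat)
  (A : forall i : 'I_Nsub, 'M[R]_(k i, Nens))
  (y : forall i : 'I_Nsub, 'cV[R]_(k i))
  (alpha : R) (halpha : 0 < alpha)
  (C0 : 'M[R]_Nens) (hC0 : posdefmx C0)
  (theta0 : 'I_Nens -> 'cV[R]_Nens)
  (hdim : \rank (ens_span theta0) = Nens.-1)
  (thetastar : 'cV[R]_Nens)
  (hstar : argmin (ens_affine theta0) (Phi_reg A y alpha C0) thetastar)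
  (eta : R -> R) (heta : learning_rate eta)
  (d : measure_display) (T : measurableType d) (P : probability T R)
  (i : R -> T -> 'I_Nsub) (hi : index_process P eta i)
  (theta : R -> 'I_Nens -> T -> borel_cV R Nens)
  (htheta : subsampling_TEKI_solution P
              (fun a => Phi_reg_sub A y alpha C0 a) i theta0 theta)
  (q : R) (hq : 0 < q <= 1)
  (j : 'I_Nens) (i0 : 'I_Nsub) :
  wasserstein q (@dirac _ (borel_cV R Nens) thetastar R)
    (pushforward (cond_prob P [set w | i 0 w = i0]) (theta t j))
    @[t --> +oo%R] --> 0%E.
Proof.
have [C C_gt0 HC] := mean_error_decay hNsub hNens halpha hC0 hstar heta hi htheta j.
have [mi _ Pi0 _] := hi; have [mtheta _] := htheta.
set E := [set w | i 0 w = i0].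
have mE : measurable E by exact: mi.
have N0 : 0 < Nsub%:R :> R by rewrite ltr0n ltnW.
have PE0 : P E != 0%E by rewrite Pi0 eqe gt_eqF// invr_gt0.
have q0 : 0 < q by case/andP: hq.
pose W t := wasserstein q (@dirac _ (borel_cV R Nens) thetastar R)
    (pushforward (cond_prob P E) (theta t j)).
rewrite -/(W _).
have small e : 0 < e -> \forall t \near +oo, (W t <= e%:E)%E.
  move=> e0.
  (* v is small enough for v^q, and then t is large enough for the mean error
     divided by v, to contribute at most e / 2 each after conditioning. *)
  pose u := (e / (2 * Nsub%:R)) `^ q^-1.
  have eN0 : 0 < e / (2 * Nsub%:R) by rewrite divr_gt0// mulr_gt0.
  have u0 : 0 < u by exact: powR_gt0.
  pose v := Num.min 1 u.
  have v0 : 0 < v by rewrite lt_min ltr01.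
  have v1 : v <= 1 by rewrite ge_min lexx.
  have vq : v `^ q <= e / (2 * Nsub%:R).
    apply: (@le_trans _ _ (u `^ q)).
      by rewrite ge0_ler_powR ?nnegrE ?(ltW q0) ?(ltW v0) ?(ltW u0)// ge_min lexx orbT.
    by rewrite /u -powRrM mulVf ?gt_eqF// powRr1// ltW.
  have del0 : 0 < v * (e / (2 * Nsub%:R)) by rewrite mulr_gt0.
  near=> t.
  have t0 : 0 < t by near: t; exact: nbhs_pinfty_gt.
  have tdel : C * (decay t * (1 + ln (1 + t))) <= v * (e / (2 * Nsub%:R)).
    by near: t; exact: decay_ln_small.
  apply: le_trans (wasserstein_dirac_le _ _ mE PE0 (mtheta t j (ltW t0))) _.
  rewrite Pi0 /= invrK lee_fin.
  pose Z w := Num.min 1 (enorm (thetastar - theta t j w : 'cV[R]_Nens)).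
  have mZ : measurable_fun setT Z.
    apply: measurable_minr; first exact: measurable_cst.
    by apply: measurable_enorm_sub; [exact: measurable_cst|exact: mtheta (ltW t0)].
  have bZ : bounded_rv Z.
    by split => //; exists 1 => w; rewrite ger0_norm ?ge_min ?lexx// le_min ler01 sqrtr_ge0.
  have bc : bounded_rv (fun w => cost q thetastar (theta t j w)).
    split; last by exists 1 => w; rewrite ger0_norm ?cost_ge0// ge_min lexx.
    by apply: measurable_cost; [exact: measurable_cst|exact: mtheta (ltW t0)].
  have cost_le : mean P (fun w => cost q thetastar (theta t j w)) <=
      v `^ q + v^-1 * mean P Z.
    rewrite -(meanZ P _ bZ) -[v `^ q](mean_cst P) -meanD; last 2 first.
    - exact: bounded_rv_cst.
    - exact: bounded_rvZ.
    apply: mean_le => //.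
      by apply: bounded_rvD; [exact: bounded_rv_cst|exact: bounded_rvZ].
    by move=> w; rewrite [_^-1 * _]mulrC; apply: min_powR_le => //; exact: sqrtr_ge0.
  have Zle : v^-1 * mean P Z <= e / (2 * Nsub%:R).
    by rewrite ler_pdivrMl// (le_trans (HC t t0)).
  apply: (@le_trans _ _ (Nsub%:R * (e / (2 * Nsub%:R) + e / (2 * Nsub%:R)))).
    by rewrite ler_wpM2l ?(ltW N0)// (le_trans cost_le)// lerD.
  by rewrite le_eqVlt; apply/orP; left; apply/eqP; field; rewrite gt_eqF.
have W0 t : (0 <= W t)%E by exact: wasserstein_ge0.
have fin : \forall t \near +oo, W t \is a fin_num.
  apply: filterS (small 1 ltr01) => t W1.
  by rewrite ge0_fin_numE// (le_lt_trans W1)// ltry.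
apply: cvg_EFin => //; apply/cvgrPdist_le => e e0.
near=> t.
rewrite /= sub0r normrN ger0_norm; last by apply: fine_ge0; exact: W0.
rewrite -lee_fin fineK; last by near: t; exact: fin.
by near: t; exact: small.
Unshelve. all: by end_near. Qed.
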